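(* Let $P$ be a locally geometric poset. The sheaf $\mathcal{F}(P)$ of Orlik–Solomon algebras on $P$ is a flasque sheaf, and its algebra of global sections is isomorphic to the Orlik–Solomon algebra $A(P)$.
   Context: All posets are finite. For a poset $P$ and $x\in P$, $P_{\le x}=\{y\in P: y\le x\}$. For $T\subseteq P$, $\bigvee T$ is the set of minimal common upper bounds of $T$ and $\bigwedge T$ the set of maximal common lower bounds; $x\vee y$ and $x\wedge y$ denote the sets $\bigvee\{x,y\}$ and $\bigwedge\{x,y\}$. A lattice is a poset in which all $x\vee y$ and $x\wedge y$ are singletons. A poset with minimum $\hat 0$ is ranked if there is an order-preserving $\rho:P\to\mathbb{Z}_{\ge0}$ with $\rho(\hat 0)=0$ and $\rho(y)=\rho(x)+1$ whenever $y$ covers $x$; $\operatorname{at}(P)$ is the set of rank-one elements (atoms). A geometric lattice is a ranked lattice that is atomic (every element is a join of atoms) and semimodular ($\rho(x)+\rho(y)\ge\rho(x\vee y)+\rho(x\wedge y)$). $P$ is locally geometric if it is ranked, has a minimum $\hat 0$, and $P_{\le x}$ is a geometric lattice for every $x\in P$. For a locally geometric poset $P$, let $S=S(P)=\{(x,T): T\subseteq\operatorname{at}(P),\ x\in\bigvee T\}$, a subposet of $P\times 2^{\operatorname{at}(P)}$ with minimum $\hat 0=(\hat 0,\varnothing)$, and $I=I(P)=\{(x,T)\in S:\rho(x)=|T|\}$. Each $S_{\le\alpha}$ is a Boolean lattice. For $\alpha=(x,T)\in S$, $\operatorname{at}(\alpha)$ is the set of atoms $(a,\{a\})$, $a\in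 T$, of $S$ below $\alpha$ (identified with $T$), $|\alpha|=|T|$, and for $a\in\operatorname{at}(\alpha)$, $\alpha\setminus a$ is the unique element of $S_{\le\alpha}$ with atom set $\operatorname{at}(\alpha)\setminus\{a\}$. Joins and meets of elements of $S$ are taken in $S$. A circuit is a minimal element of $S\setminus I$; $\omega\in S$ is $\zeta$-unicircular if $\zeta$ is the unique circuit with $\zeta\le\omega$. Fix a linear order on $\operatorname{at}(P)$, inducing one on the atoms of each $P_{\le x}$. For elements (or sets of atoms) with disjoint atom sets $A,B$, $\operatorname{sgn}(A,B)$ is the sign of the permutation sorting the concatenation of $A$ and $B$ (each listed increasingly) into increasing order. $E(P)$ is the free graded-commutative $\mathbb{Q}$-algebra on generators $e_\alpha$, $\alpha\in I\setminus\{\hat 0\}$, with $\deg e_\alpha=|\alpha|$. $J(P)\subseteq E(P)$ is the ideal generated by: (i) $e_\alpha e_\beta$ when $\alpha\wedge\beta\ne\{\hat 0\}$; (ii) $e_\alpha e_\beta-\operatorname{sgn}(\alpha,\beta)\sum_{\gamma\in(\alpha\vee\beta)\cap I}e_\gamma$ when $\alpha\wedge\beta=\{\hat 0\}$; (iii) $\sum_{a\in\operatorname{at}(\zeta)}\operatorname{sgn}(a,\omega\setminus a)e_{\omega\setminus a}$ when $\omega$ is $\zeta$-unicircular. The Orlik–Solomon algebra is $A(P)=E(P)/J(P)$. For $x\ge y$ in $P$ there is a surjective algebra homomorphism $r^x_y:A(P_{\le x})\to A(P_{\le y})$ sending $e_\alpha$ to $e_\alpha$ if $\alpha\in I(P_{\le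 y})$ and to $0$ otherwise. Viewing $P$ as a category with a morphism $x\to y$ whenever $x\ge y$, $x\mapsto A(P_{\le x})$ with the maps $r^x_y$ is a functor to $\mathbb{Q}$-algebras. Give $P$ the Alexandroff topology whose open sets are the order ideals (downward-closed subsets), with basis $\{P_{\le x}\}$; the corresponding sheaf of algebras is $\mathcal{F}(P)$, with sections over an order ideal $U$ equal to $\{(a_x)_{x\in U}\in\prod_{x\in U}A(P_{\le x}): r^x_y(a_x)=a_y\text{ whenever }y\le x\}$. Flasque means that all restriction maps between open sets are surjective. *)

(* Defs.v *)
From HB Require Import structures.
From mathcomp Require Import all_boot all_order all_fingroup all_algebra.
From mathcomp Require Import generic_quotient boolp.
From mathcomp.multinomials Require Import monalg.

Set Implicit Arguments.
Unset Strict Implicit.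
Unset Printing Implicit Defensive.

Import Order.TTheory GRing.Theory.

Local Open Scope order_scope.

Section Poset.
Context {d : Order.disp_t} {P : finPOrderType d}.
Implicit Types (T : {set P}) (x y z : P).

Definition upper_bound T z := [forall t in T, t <= z].
Definition lower_bound T z := [forall t in T, z <= t].

Definition joins T : {set P} :=
  [set z | upper_bound T z & [forall w, upper_bound T w ==> ~~ (w < z)]].
Definition meets T : {set P} :=
  [set z | lower_bound T z & [forall w, lower_bound T w ==> ~~ (z < w)]].

Definition covers y x := (x < y) && [forall z, ~~ (x < z < y)].

End Poset.

Definition is_lattice {d} (P : finPOrderType d) :=
  forall x y : P, #|joins [set x; y]| = 1%N /\ #|meets [set x; y]| = 1%N.

Definition linear_order_on (T : finType) (A : {set T}) (lo : rel T) :=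
  [/\ {in A, reflexive lo}, {in A &, antisymmetric lo},
      {in A & &, transitive lo} & {in A &, total lo}].

Section Ranked.
Context {d : Order.disp_t} (P : finBPOrderType d).

Definition rank_function (rho : P -> nat) :=
  [/\ {homo rho : x y / (x <= y)%O >-> (x <= y)%N}, rho \bot = 0%N
    & forall x y, covers y x -> rho y = (rho x).+1].

Definition ranked := exists rho, rank_function rho.

(* A ranked poset has only one rank function (rank_function_unique below);
   the value on a poset which is not ranked is irrelevant. *)
Definition rank : P -> nat :=
  if pselect ranked is left h then sval (cid h) else fun=> 0%N.

Definition atoms : {set P} := [set a | rank a == 1%N].

Definition atomic :=
  forall x : P, exists2 T : {set P}, T \subset atoms & joins T = [set x].

Definition semimodular :=
  forall x y j m : P, j \in joins [set x; y] -> m \in meets [set x; y] ->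
    (rank j + rank m <= rank x + rank y)%N.

Definition geometric_lattice := [/\ ranked, is_lattice P, atomic & semimodular].

End Ranked.

Arguments rank {d P}.

Section Down.
Context {d : Order.disp_t} {P : finBPOrderType d}.

Definition down (x : P) := {y : P | y <= x}.

Variable x : P.

HB.instance Definition _ := SubFinite.on (down x).
HB.instance Definition _ := [SubChoice_isSubPOrder of (down x) by <: with d].

Definition down_bot : down x := Sub \bot (le0x x).
Fact down_le0x (y : down x) : down_bot <= y.
Proof. exact: (le0x (val y)). Qed.
HB.instance Definition _ := Order.hasBottom.Build d (down x) down_le0x.

Definition down_incl (y : P) (le_yx : y <= x) (z : down y) : down x :=
  Sub (val z) (le_trans (valP z) le_yx).

End Down.

Definition locally_geometric {d} (P : finBPOrderType d) :=
  ranked P /\ forall x : P, geometric_lattice (down x).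

Definition in_S {d} {P : finBPOrderType d} (a : P * {set P}) :=
  (a.2 \subset atoms P) && (a.1 \in joins a.2).

Definition Spos {d} (P : finBPOrderType d) := {a : P * {set P} | in_S a}.

Section SposetTheory.
Context {d : Order.disp_t} {P : finBPOrderType d}.
Local Notation S := (Spos P).

HB.instance Definition _ := SubFinite.on S.

Definition atS (a : S) : {set P} := (val a).2.

Definition leS (a b : S) := ((val a).1 <= (val b).1) && (atS a \subset atS b).

Fact leS_refl : reflexive leS.
Proof. by move=> a; rewrite /leS lexx subxx. Qed.
Fact leS_anti : antisymmetric leS.
Proof.
move=> a b /andP[/andP[ab1 ab2] /andP[ba1 ba2]]; apply: val_inj.
rewrite [val a]surjective_pairing [val b]surjective_pairing; congr pair.
  by apply/eqP; rewrite eq_le ab1.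
by apply/eqP; rewrite eqEsubset; apply/andP.
Qed.
Fact leS_trans : transitive leS.
Proof.
move=> b a c /andP[ab1 ab2] /andP[bc1 bc2].
by rewrite /leS (le_trans ab1 bc1) (subset_trans ab2 bc2).
Qed.
HB.instance Definition _ := Order.Le_isPOrder.Build d S leS_refl leS_anti leS_trans.

Fact in_S0 : in_S (\bot : P, set0).
Proof.
rewrite /in_S sub0set inE /=; apply/andP; split.
  by apply/forall_inP => t; rewrite inE.
by apply/forallP => w; rewrite ltx0 implybT.
Qed.
Definition S0 : S := Sub (\bot, set0) in_S0.

Definition indep (a : S) := rank (val a).1 == #|atS a|.

Definition circuit (z : S) := ~~ indep z && [forall w : S, (w < z) ==> indep w].

Definition unicircular (z w : S) :=
  [&& circuit z, z <= w & [forall z' : S, circuit z' && (z' <= w) ==> (z' == z)]].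

(* the element of S_{<= w} with atom set at(w) \ a *)
Definition delS (w : S) (a : P) : S :=
  odflt w [pick b : S | (b <= w) && (atS b == atS w :\ a)].

End SposetTheory.

Definition Ipos {d} (P : finBPOrderType d) := {a : Spos P | indep a && (a != S0)}.
HB.instance Definition _ {d} (P : finBPOrderType d) := SubFinite.on (Ipos P).

Local Open Scope quotient_scope.
Local Open Scope ring_scope.

Section Sign.
Context {T : finType} (lo : rel T).

Definition sorting_sign (w : seq T) : rat :=
  if [pick s : 'S_(size w) |
        sorted lo [seq tnth (in_tuple w) (s i) | i <- enum 'I_(size w)]]
  is Some s then (-1) ^+ odd_perm s else 0.

Definition sgn (A B : {set T}) : rat :=
  sorting_sign (sort lo (enum A) ++ sort lo (enum B)).
End Sign.

Section Quotient.
Context {K : pzRingType} {R : algType K}.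

Definition two_sided_ideal (I : R -> Prop) :=
  [/\ I 0, forall x y, I x -> I y -> I (x - y)
    & forall a x, I x -> I (a * x) /\ I (x * a)].

Definition gen_ideal (G : R -> Prop) (x : R) :=
  forall I, two_sided_ideal I -> (forall g, G g -> I g) -> I x.

Definition gen_proper (G : R -> Prop) := ~ gen_ideal G 1.

Variable G : R -> Prop.

Lemma gen_ideal_two_sided : two_sided_ideal (gen_ideal G).
Proof.
split=> [|x y Ix Iy|a x Ix].
- by move=> I [].
- by move=> I tsI GI; case: (tsI) => _ IB _; apply: IB; [apply: Ix|apply: Iy].
split=> I tsI GI; case: (tsI) => _ _ IM.
  by case: (IM a x (Ix I tsI GI)).
by case: (IM a x (Ix I tsI GI)).
Qed.

Lemma gen_ideal_gen g : G g -> gen_ideal G g.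
Proof. by move=> Gg I _; apply. Qed.

Let I0 : gen_ideal G 0. Proof. by case: gen_ideal_two_sided. Qed.
Let IB x y : gen_ideal G x -> gen_ideal G y -> gen_ideal G (x - y).
Proof. by have [_ H _] := gen_ideal_two_sided; apply: H. Qed.
Let IN x : gen_ideal G x -> gen_ideal G (- x).
Proof. by move=> Ix; rewrite -sub0r; apply: IB. Qed.
Let ID x y : gen_ideal G x -> gen_ideal G y -> gen_ideal G (x + y).
Proof. by move=> Ix Iy; rewrite -[y]opprK; apply: IB => //; apply: IN. Qed.
Let IMl a x : gen_ideal G x -> gen_ideal G (a * x).
Proof. by have [_ _ H] := gen_ideal_two_sided; move=> /(H a) []. Qed.
Let IMr a x : gen_ideal G x -> gen_ideal G (x * a).
Proof. by have [_ _ H] := gen_ideal_two_sided; move=> /(H a) []. Qed.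

Definition eqmod_ideal (x y : R) := `[< gen_ideal G (x - y) >].

Fact eqmod_ideal_equiv : equiv_class_of eqmod_ideal.
Proof.
split=> [x|x y|y x z].
- by apply/asboolP; rewrite subrr.
- by apply/asboolP/asboolP => /IN; rewrite opprB.
by move=> /asboolP xy /asboolP yz; apply/asboolP; rewrite -(subrKA y); apply: ID.
Qed.
Canonical eqmod_ideal_equivRel := EquivRelPack eqmod_ideal_equiv.

(* The properness hypothesis is what makes the quotient an algType, since
   those are nontrivial rings. *)
Definition quotalg of gen_proper G := {eq_quot eqmod_ideal}.

Hypothesis prG : gen_proper G.
Local Notation Q := (quotalg prG).

HB.instance Definition _ : EqQuotient R eqmod_ideal Q := EqQuotient.on Q.
HB.instance Definition _ := Choice.on Q.

Definition quot_pi (x : R) : Q := \pi_Q x.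

Lemma quot_piP x y : quot_pi x = quot_pi y <-> gen_ideal G (x - y).
Proof.
rewrite /quot_pi; split=> [/eqP|xy]; first by rewrite piE => /asboolP.
by apply/eqP; rewrite piE; apply/asboolP.
Qed.

Lemma quot_repr (a : Q) : quot_pi (repr a) = a.
Proof. exact: reprK. Qed.

Lemma quot_reprP x : gen_ideal G (repr (quot_pi x) - x).
Proof. by apply/quot_piP; rewrite quot_repr. Qed.

Definition q_add (a b : Q) := quot_pi (repr a + repr b).
Definition q_opp (a : Q) := quot_pi (- repr a).
Definition q_mul (a b : Q) := quot_pi (repr a * repr b).
Definition q_scale (k : K) (a : Q) := quot_pi (k *: repr a).

Fact q_addE x y : q_add (quot_pi x) (quot_pi y) = quot_pi (x + y).
Proof. by apply/quot_piP; rewrite opprD addrACA; apply: ID; apply: quot_reprP. Qed.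
Fact q_oppE x : q_opp (quot_pi x) = quot_pi (- x).
Proof. by apply/quot_piP; rewrite -opprD; apply: IN; apply: quot_reprP. Qed.
Fact q_mulE x y : q_mul (quot_pi x) (quot_pi y) = quot_pi (x * y).
Proof.
apply/quot_piP; set x' := repr _; set y' := repr _.
have -> : x' * y' - x * y = (x' - x) * y' + x * (y' - y).
  by rewrite mulrBl mulrBr subrKA.
by apply: ID; [apply: IMr|apply: IMl]; apply: quot_reprP.
Qed.
Fact q_scaleE k x : q_scale k (quot_pi x) = quot_pi (k *: x).
Proof.
apply/quot_piP; rewrite -scalerBr -[_ - _]mul1r scalerAl.
by apply: IMl; apply: quot_reprP.
Qed.

Let qE := (q_addE, q_oppE, q_mulE, q_scaleE).

Fact q_addA : associative q_add.
Proof.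
by move=> a b c; rewrite -[a]quot_repr -[b]quot_repr -[c]quot_repr !qE addrA.
Qed.
Fact q_addC : commutative q_add.
Proof. by move=> a b; rewrite -[a]quot_repr -[b]quot_repr !qE addrC. Qed.
Fact q_add0 : left_id (quot_pi 0) q_add.
Proof. by move=> a; rewrite -[a]quot_repr !qE add0r. Qed.
Fact q_addN : left_inverse (quot_pi 0) q_opp q_add.
Proof. by move=> a; rewrite -[a]quot_repr !qE addNr. Qed.
HB.instance Definition _ := GRing.isZmodule.Build Q q_addA q_addC q_add0 q_addN.

Fact q_mulA : associative q_mul.
Proof.
by move=> a b c; rewrite -[a]quot_repr -[b]quot_repr -[c]quot_repr !qE mulrA.
Qed.
Fact q_mul1 : left_id (quot_pi 1) q_mul.
Proof. by move=> a; rewrite -[a]quot_repr !qE mul1r. Qed.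
Fact q_mulr1 : right_id (quot_pi 1) q_mul.
Proof. by move=> a; rewrite -[a]quot_repr !qE mulr1. Qed.
Fact q_mulDl : left_distributive q_mul q_add.
Proof.
by move=> a b c; rewrite -[a]quot_repr -[b]quot_repr -[c]quot_repr !qE mulrDl.
Qed.
Fact q_mulDr : right_distributive q_mul q_add.
Proof.
by move=> a b c; rewrite -[a]quot_repr -[b]quot_repr -[c]quot_repr !qE mulrDr.
Qed.
Fact q_oner_neq0 : quot_pi 1 != quot_pi 0.
Proof. by apply/eqP => /quot_piP; rewrite subr0. Qed.
HB.instance Definition _ :=
  GRing.Zmodule_isNzRing.Build Q q_mulA q_mul1 q_mulr1 q_mulDl q_mulDr q_oner_neq0.

Fact q_scaleA k l a : q_scale k (q_scale l a) = q_scale (k * l) a.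
Proof. by rewrite -[a]quot_repr !qE scalerA. Qed.
Fact q_scale1 : left_id 1 q_scale.
Proof. by move=> a; rewrite -[a]quot_repr !qE scale1r. Qed.
Fact q_scaleDr : right_distributive q_scale +%R.
Proof.
move=> k a b; rewrite -[a]quot_repr -[b]quot_repr.
by rewrite -[_ + _]/(q_add _ _) -[RHS]/(q_add _ _) !qE scalerDr.
Qed.
Fact q_scaleDl a : {morph q_scale^~ a : k l / k + l}.
Proof. by move=> k l; rewrite -[a]quot_repr -[RHS]/(q_add _ _) !qE scalerDl. Qed.
HB.instance Definition _ :=
  GRing.Zmodule_isLmodule.Build K Q q_scaleA q_scale1 q_scaleDr q_scaleDl.

Fact q_scaleAl k (a b : Q) : k *: (a * b) = (k *: a) * b.
Proof.
rewrite -[a]quot_repr -[b]quot_repr -[LHS]/(q_scale _ (q_mul _ _)).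
by rewrite -[RHS]/(q_mul (q_scale _ _) _) !qE scalerAl.
Qed.
HB.instance Definition _ := GRing.Lmodule_isLalgebra.Build K Q q_scaleAl.
Fact q_scaleAr k (a b : Q) : k *: (a * b) = a * (k *: b).
Proof.
rewrite -[a]quot_repr -[b]quot_repr -[LHS]/(q_scale _ (q_mul _ _)).
by rewrite -[RHS]/(q_mul _ (q_scale _ _)) !qE scalerAr.
Qed.
HB.instance Definition _ := GRing.Lalgebra_isAlgebra.Build K Q q_scaleAr.

Fact quot_pi_zmod : zmod_morphism quot_pi.
Proof. by move=> x y; rewrite -q_addE -q_oppE. Qed.
Fact quot_pi_monoid : monoid_morphism quot_pi.
Proof. by split=> // x y; rewrite -q_mulE. Qed.
Fact quot_pi_scalable : scalable quot_pi.
Proof. by move=> k x; rewrite -q_scaleE. Qed.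
HB.instance Definition _ := GRing.isZmodMorphism.Build R Q quot_pi quot_pi_zmod.
HB.instance Definition _ :=
  GRing.isMonoidMorphism.Build R Q quot_pi quot_pi_monoid.
HB.instance Definition _ :=
  GRing.isScalable.Build K R Q *:%R quot_pi quot_pi_scalable.

Lemma quot_piW (T : Q -> Prop) : (forall x, T (quot_pi x)) -> forall a, T a.
Proof. by move=> Tpi a; rewrite -[a]quot_repr. Qed.

(* The map induced by f on the quotient; it only makes sense when f kills G,
   see quot_liftE. *)
Definition quot_lift (B : Type) (f : R -> B) (a : Q) : B := f (repr a).

Lemma quot_liftE (B : pzRingType) (f : R -> B) :
  zmod_morphism f -> monoid_morphism f -> (forall g, G g -> f g = 0) ->
  forall x, quot_lift f (quot_pi x) = f x.
Proof.
move=> fB [f1 fM] fG x; apply/eqP; rewrite -subr_eq0 -fB; apply/eqP.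
apply: (quot_reprP x (I := fun y => f y = 0)) => //.
have f0 : f 0 = 0 by rewrite -(subrr 0) fB subrr.
split=> // [y z fy fz|a y fy]; first by rewrite fB fy fz subrr.
by rewrite !fM fy mulr0 mul0r.
Qed.

Lemma quot_lift_hom (B : pzRingType) (f : R -> B) :
  zmod_morphism f -> monoid_morphism f -> (forall g, G g -> f g = 0) ->
  zmod_morphism (quot_lift f) /\ monoid_morphism (quot_lift f).
Proof.
move=> fB fM fG; have E := quot_liftE fB fM fG; case: (fM) => f1 fMM.
split; last split.
- elim/quot_piW=> x; elim/quot_piW=> y.
  by rewrite -rmorphB !E fB.
- by rewrite -(rmorph1 quot_pi) E.
- elim/quot_piW=> x; elim/quot_piW=> y.
  by rewrite -rmorphM !E fMM.
Qed.

End Quotient.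

Lemma gen_proper_hom (K : pzRingType) (R : algType K) (B : nzRingType)
    (f : R -> B) (G : R -> Prop) :
  zmod_morphism f -> monoid_morphism f -> (forall g, G g -> f g = 0) -> gen_proper G.
Proof.
move=> fB [f1 fM] fG /(_ (fun y => f y = 0)) H; have := oner_eq0 B.
rewrite -f1 H ?eqxx //; have f0 : f 0 = 0 by rewrite -(subrr 0) fB subrr.
split=> // [y z fy fz|a y fy]; first by rewrite fB fy fz subrr.
by rewrite !fM fy mulr0 mul0r.
Qed.

Section FreeAlgebra.
Variable I : choiceType.

Definition freealg := {malg rat[{fmonom I}]}.
HB.instance Definition _ := GRing.Lalgebra.on freealg.

Fact freealg_scalerAr (k : rat) (x y : freealg) : k *: (x * y) = x * (k *: y).
Proof.
suff: scalable ( *%R x) by move=> ->.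
by apply: rat_linear => u v; rewrite mulrBr.
Qed.
HB.instance Definition _ :=
  GRing.Lalgebra_isAlgebra.Build rat freealg freealg_scalerAr.

Definition free_gen (i : I) : freealg := << fmu i >>.

Definition monom_prod (B : pzRingType) (f : I -> B) (m : {fmonom I}) : B :=
  \prod_(i <- (m : seq I)) f i.

Fact monom_prod_morph (B : nzRingType) (f : I -> B) :
  mmorphism (monom_prod f).
Proof.
split; rewrite /monom_prod; last by rewrite fm1 big_nil.
by move=> m n; rewrite fmM big_cat.
Qed.

HB.instance Definition _ (B : nzRingType) (f : I -> B) :=
  monalg.isMultiplicative.Build _ B (monom_prod f) (monom_prod_morph f).

(* the algebra map sending the i-th generator to f i *)
Definition free_lift (B : algType rat) (f : I -> B) : freealg -> B :=
  mmap (GRing.in_alg B) (monom_prod f).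

Lemma free_lift_gen (B : algType rat) (f : I -> B) i :
  free_lift f (free_gen i) = f i.
Proof.
by rewrite /free_lift mmapU /= scale1r mul1r /monom_prod fmU big_seq1.
Qed.

Lemma free_lift_zmod (B : algType rat) (f : I -> B) : zmod_morphism (free_lift f).
Proof. by move=> x y; apply: (raddfB (mmap _ _)). Qed.

Lemma free_lift_scalable (B : algType rat) (f : I -> B) : scalable (free_lift f).
Proof. exact: rat_linear (free_lift_zmod f). Qed.

Lemma free_lift_monoid (B : algType rat) (f : I -> B) :
  monoid_morphism (free_lift f).
Proof.
have [|M1 M2] := @commr_mmap_is_multiplicative _ _ _ (GRing.in_alg B) (monom_prod f).
  by move=> g m n; rewrite /GRing.comm /= -scalerAl -scalerAr mul1r mulr1.
by split=> // x y; apply: M1.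
Qed.

End FreeAlgebra.

Section GradedCommutative.
Variables (I : choiceType) (deg : I -> nat).

Definition gcomm_rel (x : freealg I) := exists i j : I,
  x = free_gen i * free_gen j
      - (-1) ^+ (deg i * deg j) *: (free_gen j * free_gen i).

Fact gcomm_proper : gen_proper gcomm_rel.
Proof.
pose ep : freealg I -> rat := mcoeff (mone : {fmonom I}).
have epgen i : ep (free_gen i) = 0.
  rewrite /ep mcoeffU; case: eqP => // /(congr1 (fun m : {fmonom I} => size m)).
  by rewrite fmU fm1.
have [ep1 epM] : monoid_morphism ep.
  by split; [apply: rmorph1 (mcoeff _)|apply: rmorphM (mcoeff _)].
have epB : zmod_morphism ep by move=> x y; apply: (raddfB (mcoeff _)).
have epZ k x : ep (k *: x) = k * ep x by apply: mcoeffZ.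
apply: (@gen_proper_hom _ (freealg I) rat ep) => // _ [i [j ->]].
apply: etrans (epB _ _) _; apply: etrans (congr1 _ (congr1 _ (epZ _ _))) _.
by rewrite 2!epM !epgen !mulr0 subr0.
Qed.

(* The free graded-commutative algebra.  The square of an odd generator
   vanishes since 2 is invertible. *)
Definition gcalg := quotalg gcomm_proper.
HB.instance Definition _ := GRing.Algebra.on gcalg.

Definition gc_gen (i : I) : gcalg := quot_pi gcomm_proper (free_gen i).

Lemma gcP x y : gc_gen x * gc_gen y = (-1) ^+ (deg x * deg y) *: (gc_gen y * gc_gen x).
Proof.
apply/eqP; rewrite -subr_eq0 -!rmorphM -linearZ -rmorphB -(rmorph0 (quot_pi _)).
apply/eqP/quot_piP; rewrite subr0; apply: gen_ideal_gen.
by exists x, y.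
Qed.

Section Lift.
Variables (B : algType rat) (f : I -> B).
Definition gc_lift : gcalg -> B := quot_lift (free_lift f).

Hypothesis fC : forall i j, f i * f j = (-1) ^+ (deg i * deg j) *: (f j * f i).

Let free_lift_rel g : gcomm_rel g -> free_lift f g = 0.
Proof.
move=> [i [j ->]]; have fM := (free_lift_monoid f).2.
apply: etrans (free_lift_zmod f _ _) _.
apply: etrans (congr1 _ (congr1 _ (free_lift_scalable f _ _))) _.
by rewrite 2!fM !free_lift_gen fC subrr.
Qed.

Lemma gc_lift_zmod : zmod_morphism gc_lift.
Proof.
by case: (quot_lift_hom gcomm_proper (free_lift_zmod f) (free_lift_monoid f)
  free_lift_rel).
Qed.

Lemma gc_lift_monoid : monoid_morphism gc_lift.
Proof.
by case: (quot_lift_hom gcomm_proper (free_lift_zmod f) (free_lift_monoid f)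
  free_lift_rel).
Qed.

Lemma gc_lift_gen i : gc_lift (gc_gen i) = f i.
Proof.
by rewrite /gc_lift (quot_liftE _ (free_lift_zmod f) (free_lift_monoid f))
  // free_lift_gen.
Qed.
End Lift.

End GradedCommutative.

Section OrlikSolomon.
Context {d : Order.disp_t} (P : finBPOrderType d).

Definition Ideg (a : Ipos P) := #|atS (val a)|.

Definition Ealg := gcalg Ideg.
HB.instance Definition _ := GRing.Algebra.on Ealg.

Definition e_gen (a : Ipos P) : Ealg := gc_gen Ideg a.

(* e_alpha for alpha in S; it only occurs below for alpha in I \ {0}, the
   value 0 elsewhere is irrelevant. *)
Definition e_ (a : Spos P) : Ealg := if insub a is Some b then e_gen b else 0.

Variable lo : rel P.

Inductive OS_rel : Ealg -> Prop :=
| OS_rel_meet (a b : Ipos P) :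
    meets [set val a; val b] != [set S0] ->
    OS_rel (e_gen a * e_gen b)
| OS_rel_join (a b : Ipos P) :
    meets [set val a; val b] = [set S0] ->
    OS_rel (e_gen a * e_gen b
            - sgn lo (atS (val a)) (atS (val b))
              *: \sum_(c in joins [set val a; val b] | indep c) e_ c)
| OS_rel_circuit (z w : Spos P) :
    unicircular z w ->
    OS_rel (\sum_(a in atS z) sgn lo [set a] (atS (delS w a)) *: e_ (delS w a)).

Fact OS_proper : gen_proper OS_rel.
Proof.
have [g [gM gZ ge]] : exists g : {additive Ealg -> rat^o},
    [/\ monoid_morphism g, scalable g & forall a, g (e_gen a) = 0].
  pose f (a : Ipos P) : rat^o := 0.
  have fC i j : f i * f j = (-1) ^+ (Ideg i * Ideg j) *: (f j * f i).
    by rewrite mulr0 scaler0.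
  have fB := gc_lift_zmod fC; pose F := GRing.isZmodMorphism.Build _ _ _ fB.
  pose g : {additive Ealg -> rat^o} := HB.pack (gc_lift (deg := Ideg) f) F.
  exists g; split; first exact: (gc_lift_monoid fC).
    exact: rat_linear.
  by move=> a; apply: gc_lift_gen.
have gS a : g (e_ a) = 0.
  by rewrite /e_; case: insub => [b|]; [apply: ge|apply: raddf0].
apply: (@gen_proper_hom _ _ rat g) => [|//|x]; first exact: raddfB.
case=> [a b _|a b _|z w _].
- by rewrite gM.2 ge mul0r.
- rewrite raddfB gM.2 gZ ge raddf_sum big1 => [|c _]; last exact: gS.
  by rewrite mul0r scaler0 subr0.
by rewrite raddf_sum big1 // => a _; rewrite gZ gS scaler0.
Qed.

Definition OS := quotalg OS_proper.
HB.instance Definition _ := GRing.Algebra.on OS.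

Definition OS_gen (a : Ipos P) : OS := quot_pi OS_proper (e_gen a).

End OrlikSolomon.

Arguments OS_proper {d P} lo _.

Local Open Scope order_scope.

Section FinPosetTheory.
Context {d : Order.disp_t} {P : finPOrderType d}.
Implicit Types (T : {set P}) (x y z : P).

Lemma exists_minimal (A : pred P) v : A v ->
  exists2 u, A u && (u <= v) & forall w, A w -> ~~ (w < u).
Proof.
move=> Av; pose c (u : P) := #|[set w : P | w < u]|.
have v0 : A v && (v <= v) by rewrite Av /=.
case: (arg_minnP (P := fun u => A u && (u <= v)) c v0) => u Pu umin.
exists u => // w Aw; apply/negP => wu.
have wv : A w && (w <= v).
  by rewrite Aw (le_trans (ltW wu)) //; case/andP: Pu.
have := umin w wv; rewrite leqNgt => /negP; apply; apply: proper_card.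
apply/properP; split; last by exists w; rewrite !inE ?ltxx.
by apply/subsetP => t; rewrite !inE => /lt_trans; apply.
Qed.

Lemma upper_boundP T z : reflect {in T, forall t, t <= z} (upper_bound T z).
Proof. exact: forall_inP. Qed.
Lemma lower_boundP T z : reflect {in T, forall t, z <= t} (lower_bound T z).
Proof. exact: forall_inP. Qed.

Lemma joinsP T z : reflect (upper_bound T z /\
  forall w, upper_bound T w -> w <= z -> w = z) (z \in joins T).
Proof.
rewrite inE; apply: (iffP andP) => -[ub H]; split=> //.
  move=> w ubw wz; apply/eqP; move/forallP/(_ w)/implyP/(_ ubw): H.
  by rewrite lt_neqAle wz andbT negbK.
apply/forallP=> w; apply/implyP => ubw; apply/negP => wz.
by move: (wz); rewrite (H w ubw (ltW wz)) ltxx.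
Qed.

Lemma meetsP T z : reflect (lower_bound T z /\
  forall w, lower_bound T w -> z <= w -> w = z) (z \in meets T).
Proof.
rewrite inE; apply: (iffP andP) => -[ub H]; split=> //.
  move=> w ubw wz; apply/eqP; move/forallP/(_ w)/implyP/(_ ubw): H.
  by rewrite lt_neqAle wz andbT negbK eq_sym.
apply/forallP=> w; apply/implyP => ubw; apply/negP => wz.
by move: (wz); rewrite (H w ubw (ltW wz)) ltxx.
Qed.

Lemma joins_below T v : upper_bound T v -> exists2 u, u \in joins T & u <= v.
Proof.
move=> /(exists_minimal (A := upper_bound T)) [u /andP[ubu uv] umin].
by exists u => //; rewrite inE ubu; apply/forallP => w; apply/implyP/umin.
Qed.

Lemma exists_cover x y : x < y -> exists2 z, covers z x & z <= y.
Proof.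
move=> xy; have [//|u /andP[/= xu uy] umin] := exists_minimal (A := > x) (v := y).
exists u => //; rewrite /covers xu; apply/forallP => z.
by apply/negP => /andP[xz]; apply/negP/umin.
Qed.

Lemma upper_bound2 x y z : upper_bound [set x; y] z = (x <= z) && (y <= z).
Proof.
apply/upper_boundP/andP => [H|[xz yz] t].
  by rewrite !H // !inE eqxx ?orbT.
by rewrite !inE => /orP[] /eqP ->.
Qed.
Lemma lower_bound2 x y z : lower_bound [set x; y] z = (z <= x) && (z <= y).
Proof.
apply/lower_boundP/andP => [H|[xz yz] t].
  by rewrite !H // !inE eqxx ?orbT.
by rewrite !inE => /orP[] /eqP ->.
Qed.

End FinPosetTheory.

Lemma exists_maximal {d} {P : finPOrderType d} (A : pred P) v : A v ->
  exists2 u, A u && (v <= u) & forall w, A w -> ~~ (u < w).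
Proof. exact: (@exists_minimal _ P^d). Qed.

Lemma exists_cocover {d} {P : finPOrderType d} (x y : P) : x < y ->
  exists2 z, covers y z & x <= z.
Proof.
move=> xy; have [//|u /andP[/= xu uy] umin] := exists_maximal (A := < y) (v := x).
exists u => //; rewrite /covers xu; apply/forallP => z.
by apply/negP => /andP[xz zy]; have := umin z zy; rewrite xz.
Qed.

Section MeetAbove.
Context {d : Order.disp_t} {P : finPOrderType d}.
Lemma meets_above (x y t : P) : t <= x -> t <= y ->
  exists2 m, m \in meets [set x; y] & t <= m.
Proof.
pose A := [pred u : P | (u <= x) && (u <= y)]; move=> tx ty.
have tA : A t by rewrite /= tx ty.
have [u /andP[/= Au ut] umax] := exists_maximal tA.
exists u => //; apply/meetsP; rewrite lower_bound2; split=> // w.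
rewrite lower_bound2 => /(umax w); rewrite lt_neqAle => /negP H uw.
by apply/eqP/negPn/negP => wu; apply: H; rewrite eq_sym wu.
Qed.

Hypothesis latP : is_lattice P.

Lemma lattice_joins_least (T : {set P}) u v :
  u \in joins T -> upper_bound T v -> u <= v.
Proof.
move=> /joinsP[ubu umin] ubv; have [_ /eqP/cards1P[m mE]] := latP u v.
have /meetsP[]: m \in meets [set u; v] by rewrite mE inE.
rewrite lower_bound2 => /andP[mu mv] _.
suff ubm : upper_bound T m by rewrite -(umin m ubm mu).
apply/upper_boundP => t tT.
have [||m'] := @meets_above u v t; try exact: (upper_boundP _ _ _).
  exact: (upper_boundP _ _ ubu).
  exact: (upper_boundP _ _ ubv).
by rewrite mE inE => /eqP ->.
Qed.

Lemma lattice_joins_unique (T : {set P}) u v :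
  u \in joins T -> v \in joins T -> u = v.
Proof.
move=> uj vj; apply/eqP; rewrite eq_le.
by rewrite !(@lattice_joins_least T) //; [case/joinsP: uj|case/joinsP: vj].
Qed.
End MeetAbove.

Section RankTheory.
Context {d : Order.disp_t} {P : finBPOrderType d}.

Lemma rankP : ranked P -> rank_function (rank : P -> nat).
Proof. by rewrite /rank; case: pselect => // h _; case: (cid h). Qed.

Lemma rank_function_unique (r1 r2 : P -> nat) :
  rank_function r1 -> rank_function r2 -> r1 =1 r2.
Proof.
move=> [_ r10 r1c] [_ r20 r2c] x.
apply/eqP/negPn/negP => /(exists_minimal (A := fun x => r1 x != r2 x)).
case=> u /andP[Au _] umin; have [u0|u0] := eqVneq u \bot.
  by rewrite u0 r10 r20 eqxx in Au.
have /exists_cocover[w wu _] : \bot < u by rewrite lt0x.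
have wlt : w < u by case/andP: wu.
have Aw : r1 w == r2 w by apply/negPn/negP => /umin; rewrite wlt.
by move: Au; rewrite (r1c _ _ wu) (r2c _ _ wu) (eqP Aw) eqxx.
Qed.

Hypothesis rP : ranked P.

Lemma rank0 : rank (\bot : P) = 0%N.
Proof. by have [_ ? _] := rankP rP. Qed.

Lemma rank_homo (x y : P) : x <= y -> (rank x <= rank y)%N.
Proof. by have [+ _ _] := rankP rP; apply. Qed.

Lemma rank_lt (x y : P) : x < y -> (rank x < rank y)%N.
Proof.
move=> /exists_cover[z zx zy]; have [_ _ /(_ _ _ zx) <-] := rankP rP.
exact: rank_homo.
Qed.

Lemma rank_le_eq (x y : P) : x <= y -> (rank y <= rank x)%N -> x = y.
Proof.
by rewrite le_eqVlt => /orP[/eqP//|/rank_lt]; rewrite ltnNge => /negbTE ->.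
Qed.
End RankTheory.

Section SposTheory2.
Context {d : Order.disp_t} {P : finBPOrderType d}.
Implicit Types a b w z : Spos P.

Lemma leSE a b : (a <= b) = ((val a).1 <= (val b).1) && (atS a \subset atS b).
Proof. by []. Qed.

Lemma SposP a : atS a \subset atoms P /\ (val a).1 \in joins (atS a).
Proof. by apply/andP; apply: (valP a). Qed.

Lemma Spos_eq a b : (val a).1 = (val b).1 -> atS a = atS b -> a = b.
Proof.
move=> e1 e2; apply: val_inj.
by rewrite [val a]surjective_pairing [val b]surjective_pairing e1 -/(atS a) e2.
Qed.

End SposTheory2.

Section GeometricLattice.
Context {d : Order.disp_t} {L : finBPOrderType d}.
Hypothesis geoL : geometric_lattice L.
Let rL : ranked L. Proof. by case: geoL. Qed.
Let latL : is_lattice L. Proof. by case: geoL. Qed.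
Let smL : semimodular L. Proof. by case: geoL. Qed.

Lemma rank_join_le (T : {set L}) z :
  T \subset atoms L -> z \in joins T -> (rank z <= #|T|)%N.
Proof.
have [n] := ubnP #|T|; elim: n T z => // n IH T z Tn Tat zT.
have [T0|[a aT]] := set_0Vmem T.
  suff -> : z = \bot by rewrite rank0.
  apply/esym; case/joinsP: zT => _; apply; rewrite ?le0x // T0.
  by apply/upper_boundP => t; rewrite inE.
have /joinsP[/upper_boundP ubz zmin] := zT.
have subT : T :\ a \subset T by rewrite subD1set.
have [|w wT wz] := @joins_below _ _ (T :\ a) z.
  by apply/upper_boundP => t /(subsetP subT)/ubz.
have cT : #|T| = #|T :\ a|.+1 by rewrite (cardsD1 a T) aT.
have rw : (rank w <= #|T :\ a|)%N.
  by apply: IH => //; [rewrite -ltnS -cT|apply: subset_trans Tat].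
have [|j jwa jz] := @joins_below _ _ [set w; a] z.
  by rewrite upper_bound2 wz ubz.
have jz' : j = z.
  apply: zmin => //; apply/upper_boundP => t tT.
  case/joinsP: jwa; rewrite upper_bound2 => /andP[wj aj] _.
  have [->//|ta] := eqVneq t a; apply: le_trans wj.
  by case/joinsP: wT => /upper_boundP ubw _; apply: ubw; rewrite !inE ta.
have [m mwa _] := @meets_above _ _ w a \bot (le0x _) (le0x _).
have := smL jwa mwa; rewrite jz' => /(leq_trans (leq_addr _ _)) /leq_trans.
apply; rewrite cT -addn1 leq_add //.
by move/subsetP/(_ a aT): Tat; rewrite inE => /eqP ->.
Qed.

Lemma geo_del_unique (w b b' : Spos L) : b <= w -> b' <= w ->
  atS b = atS b' -> b = b'.
Proof.
move=> _ _ e; apply: Spos_eq => //.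
have [_ j1] := SposP b; have [_ j2] := SposP b'.
by apply: (lattice_joins_unique latL j1); rewrite e.
Qed.

Lemma geo_circuit_closure (z w b : Spos L) a :
  circuit z -> z <= w -> a \in atS z -> b <= w -> atS b = atS w :\ a ->
  (val b).1 = (val w).1.
Proof.
move=> /andP[nz /forallP zmin] zw az; rewrite leSE => /andP[bw _] be.
have [zat zj] := SposP z; have [bat bj] := SposP b; have [wat wj] := SposP w.
have /joinsP[/upper_boundP ubz _] := zj.
have [|u uj uz] := @joins_below _ _ (atS z :\ a) (val z).1.
  by apply/upper_boundP => t /setD1P[_]; apply: ubz.
have uS : in_S (u, atS z :\ a).
  by rewrite /in_S uj (subset_trans _ zat) // subD1set.
have cz : #|atS z| = #|atS z :\ a|.+1 by rewrite (cardsD1 a) az.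
pose u' : Spos L := Sub (u, atS z :\ a) uS.
have uz' : u' < z.
  rewrite lt_neqAle leSE uz subD1set !andbT; apply/eqP => /(congr1 atS) E.
  by have := ltnn #|atS z|; rewrite {2}cz -{1}E ltnS leqnn.
have /eqP ru : indep u' by have := zmin u'; rewrite uz'.
have uzE : u = (val z).1.
  apply: (rank_le_eq rL) => //; rewrite [rank u]ru -ltnS.
  rewrite [#|atS u'|.+1](_ : _ = #|atS z|); last by rewrite cz.
  by rewrite ltn_neqAle [_ != _]nz rank_join_le.
have au : a <= u by rewrite uzE ubz.
have ub : u <= (val b).1.
  apply: (lattice_joins_least latL uj); apply/upper_boundP => t /setD1P[ta tz].
  case/joinsP: bj => /upper_boundP ubb _; apply: ubb; rewrite be !inE ta /=.
  by move: zw; rewrite leSE => /andP[_ /subsetP]; apply.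
case/joinsP: wj => _; apply=> //; apply/upper_boundP => t tw.
have [->|ta] := eqVneq t a; first exact: le_trans ub.
by case/joinsP: bj => /upper_boundP ubb _; apply: ubb; rewrite be !inE ta.
Qed.

End GeometricLattice.

Section OrderEmbedding.
Context {dP dQ : Order.disp_t} {P : finPOrderType dP} {Q : finPOrderType dQ}.
Variable f : Q -> P.
Hypothesis f_mono : {mono f : x y / x <= y}.
Hypothesis f_down : forall p q, p <= f q -> exists q', f q' = p.

Lemma emb_inj : injective f. Proof. exact: inc_inj f_mono. Qed.
Lemma emb_lt : {mono f : x y / x < y}. Proof. exact: leW_mono f_mono. Qed.

Lemma emb_ub (T : {set Q}) z : upper_bound (f @: T) (f z) = upper_bound T z.
Proof.
apply/upper_boundP/upper_boundP => [H t tT|H _ /imsetP[t tT ->]].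
  by rewrite -f_mono H // imset_f.
by rewrite f_mono H.
Qed.

Lemma emb_joins (T : {set Q}) z : (f z \in joins (f @: T)) = (z \in joins T).
Proof.
apply/joinsP/joinsP; rewrite emb_ub => -[ub H]; split=> // w.
  by rewrite -emb_ub -f_mono => u l; apply: emb_inj; apply: H.
move=> u /[dup] l /f_down[w' e]; rewrite -e; congr f; apply: H.
  by rewrite -emb_ub e.
by rewrite -f_mono e.
Qed.

Lemma emb_meets x y : meets [set f x; f y] = f @: meets [set x; y].
Proof.
apply/setP => p; apply/meetsP/imsetP.
  move=> [+ H]; rewrite lower_bound2 => /andP[zx zy].
  have [z e] := f_down zx; subst p.
  exists z => //; apply/meetsP; rewrite lower_bound2 -!f_mono zx zy.
  split=> // w; rewrite lower_bound2 => /andP[wx wy] zw; apply: emb_inj.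
  by apply: H; rewrite ?lower_bound2 !f_mono ?wx.
move=> [z /meetsP[+ H] ->]; rewrite !lower_bound2 !f_mono => zxy; split=> // w.
rewrite lower_bound2 => /andP[wx wy] zw.
have [z' e] := f_down wx; subst w; congr f.
by apply: H; rewrite ?lower_bound2 -!f_mono ?wx.
Qed.

Lemma emb_covers y x : covers (f y) (f x) = covers y x.
Proof.
rewrite /covers emb_lt; congr andb; apply/forallP/forallP => H z.
  by rewrite -2!emb_lt.
apply/negP => /andP[xz zy]; have [z' e] := f_down (ltW zy).
by move: (H z'); rewrite -2!emb_lt e xz zy.
Qed.

Lemma emb_joins_in (T : {set Q}) p :
  p \in joins (f @: T) -> (p \in codom f) ->
  exists2 z, p = f z & z \in joins T.
Proof. by move=> pj /codomP[z e]; exists z => //; rewrite -emb_joins -e. Qed.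

End OrderEmbedding.

Section IdealEmbedding.
Context {dP dQ : Order.disp_t} {P : finBPOrderType dP} {Q : finBPOrderType dQ}.
Variable i : Q -> P.
Hypothesis i_mono : {mono i : x y / x <= y}.
Hypothesis i_down : forall p q, p <= i q -> exists q', i q' = p.
Hypothesis rP : ranked P.

Let i_inj : injective i := emb_inj i_mono.

Lemma emb_bot : i \bot = \bot.
Proof.
have [q e] := i_down (le0x (i \bot)).
by apply/eqP; rewrite eq_le le0x andbT -[X in _ <= X]e i_mono le0x.
Qed.

Lemma emb_rank_function : rank_function (fun q : Q => rank (i q)).
Proof.
have [rh r0 rc] := rankP rP; split=> [x y|| x y].
- by rewrite -i_mono; apply: rh.
- by rewrite emb_bot.
by rewrite -(emb_covers i_mono) //; apply: rc.
Qed.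

Lemma emb_ranked : ranked Q.
Proof. by exists (fun q => rank (i q)); apply: emb_rank_function. Qed.

Lemma emb_rank q : rank (i q) = rank q.
Proof.
exact: (rank_function_unique emb_rank_function (rankP emb_ranked)).
Qed.

Lemma emb_atoms q : (i q \in atoms P) = (q \in atoms Q).
Proof. by rewrite !inE emb_rank. Qed.

Definition emb_pair (a : Q * {set Q}) : P * {set P} := (i a.1, i @: a.2).

Lemma emb_in_S a : in_S (emb_pair a) = in_S a.
Proof.
rewrite /in_S /= (emb_joins i_mono) //; congr andb.
apply/subsetP/subsetP => [H q qa|H _ /imsetP[q qa ->]].
  by rewrite -emb_atoms H // imset_f.
by rewrite emb_atoms H.
Qed.

Definition embS (a : Spos Q) : Spos P :=
  Sub (emb_pair (val a)) (etrans (emb_in_S (val a)) (valP a)).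

Lemma embS1 a : (val (embS a)).1 = i (val a).1. Proof. by []. Qed.
Lemma atS_embS a : atS (embS a) = i @: atS a. Proof. by []. Qed.

Lemma imset_subset (A B : {set Q}) : (i @: A \subset i @: B) = (A \subset B).
Proof.
apply/idP/idP => [/subsetP H|]; last exact: imsetS.
by apply/subsetP => x xA; rewrite -(mem_imset _ _ i_inj) H // imset_f.
Qed.

Lemma embS_mono : {mono embS : a b / a <= b}.
Proof. by move=> a b; rewrite !leSE embS1 i_mono atS_embS imset_subset. Qed.

Lemma embS_codom (b : Spos P) : (b \in codom embS) = ((val b).1 \in codom i).
Proof.
apply/codomP/codomP => [[a ->]|[q e]]; first by exists (val a).1.
have [_ /joinsP[/upper_boundP ub _]] := SposP b.
have bE : emb_pair (q, i @^-1: atS b) = val b.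
  rewrite [RHS]surjective_pairing /emb_pair /= -e; congr pair.
  apply/setP => t; apply/imsetP/idP => [[t']|tb].
    by rewrite inE => + ->.
  have := ub t tb; rewrite e => /i_down[t' t'e]; exists t' => //.
  by rewrite inE t'e.
have aS : in_S (q, i @^-1: atS b) by rewrite -emb_in_S bE; apply: valP.
by exists (Sub _ aS); apply: val_inj; rewrite -bE.
Qed.

Lemma embS_down b a : b <= embS a -> exists a', embS a' = b.
Proof.
rewrite leSE => /andP[/i_down[q e] _].
suff /codomP[a' ->] : b \in codom embS by exists a'.
by rewrite embS_codom -e codom_f.
Qed.

Let embS_inj : injective embS := emb_inj embS_mono.

Lemma embS0 : embS S0 = S0.
Proof. by apply: Spos_eq; rewrite ?embS1 ?atS_embS /= ?emb_bot // /atS /= imset0. Qed.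

Lemma embS_indep a : indep (embS a) = indep a.
Proof. by rewrite /indep embS1 emb_rank atS_embS card_imset. Qed.

Lemma embS_circuit a : circuit (embS a) = circuit a.
Proof.
rewrite /circuit embS_indep; congr andb; apply/forallP/forallP => H w.
  by rewrite -embS_indep -(emb_lt embS_mono).
apply/implyP => wa; have [w' e] := embS_down (ltW wa); rewrite -e embS_indep.
by apply: (implyP (H w')); rewrite -(emb_lt embS_mono) e.
Qed.

Lemma embS_unicircular z w : unicircular z (embS w) ->
  exists2 z', z = embS z' & unicircular z' w.
Proof.
move=> /and3P[cz /[dup] zw /embS_down[z' e] /forallP H].
exists z' => //; rewrite /unicircular -embS_circuit -embS_mono e cz zw /=.
apply/forallP => y; rewrite -embS_circuit -embS_mono.
by rewrite -(inj_eq embS_inj) e; apply: H.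
Qed.

Lemma embS_del (w : Spos Q) (a : Q) :
  (forall b b', b <= embS w -> b' <= embS w -> atS b = atS b' -> b = b') ->
  delS (embS w) (i a) = embS (delS w a).
Proof.
move=> U; rewrite /delS.
have iD : i @: (atS w :\ a) = atS (embS w) :\ i a.
  apply/setP => t; rewrite !inE atS_embS.
  apply/imsetP/andP => [[q /setD1P[qa qw] ->]|[ta /imsetP[q qw e]]].
    by rewrite (inj_eq i_inj) imset_f.
  by exists q => //; rewrite !inE qw andbT; apply: contraNneq ta => <-; rewrite e.
case: pickP => [b /andP[bw /eqP be]|N] /=; case: pickP => [b' /andP[bw' /eqP be']|N'] //=.
- by apply: U; rewrite ?embS_mono // be -iD -be'.
- have [b1 e] := embS_down bw; have /negP[] := negbT (N' b1).
  rewrite -embS_mono e bw /=; apply/eqP.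
  by apply: (imset_inj i_inj); rewrite -atS_embS e be iD.
have /negP[] := negbT (N (embS b')).
by rewrite embS_mono bw' -iD -be' eqxx.
Qed.

End IdealEmbedding.

Section SignEnum.
Variables (T : finType) (loT : rel T).

Local Open Scope ring_scope.

Lemma sorting_signE (w : seq T) n (e : size w = n) (x0 : T) :
  sorting_sign loT w =
  if [pick s : 'S_n | sorted loT [seq nth x0 w (s i) | i <- enum 'I_n]]
  is Some s then (-1) ^+ odd_perm s else 0.
Proof.
case: n / e; rewrite /sorting_sign.
congr (if _ is Some s then _ else _); apply: eq_pick => s.
by congr sorted; apply: eq_map => i; rewrite (tnth_nth x0).
Qed.

End SignEnum.

Section SignTransport.
Variables (T U : finType) (f : T -> U) (loT : rel T) (loU : rel U).
Hypothesis f_inj : injective f.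
Hypothesis lof : forall a b, loT a b = loU (f a) (f b).

Local Open Scope ring_scope.

Lemma sorting_sign_map (w : seq T) :
  sorting_sign loU (map f w) = sorting_sign loT w.
Proof.
case: w => [|x0 w]; first rewrite /= /sorting_sign.
  congr (if _ is Some s then _ else _); apply: eq_pick => s /=.
  by rewrite (size0nil (_ : size (enum 'I_0) = 0%N)) // size_enum_ord.
rewrite (sorting_signE _ (size_map f (x0 :: w)) (f x0)).
rewrite (sorting_signE _ (erefl (size (x0 :: w))) x0).
congr (if _ is Some s then _ else _); apply: eq_pick => s.
rewrite [X in sorted loU X](_ : _ =
    map f [seq nth x0 (x0 :: w) (s i) | i <- enum 'I_(size (x0 :: w))]).
  by rewrite sorted_map; apply: eq_sorted => a b /=; rewrite lof.
rewrite -map_comp; apply: eq_map => i.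
exact: (nth_map x0 (f x0) f (ltn_ord (s i))).
Qed.

Lemma sgn_imset (At : {set U}) (A B : {set T}) : linear_order_on At loU ->
  f @: A \subset At -> f @: B \subset At ->
  sgn loU (f @: A) (f @: B) = sgn loT A B.
Proof.
move=> [_ anti trans tot] sA sB; rewrite /sgn.
have sortE (C : {set T}) : f @: C \subset At ->
    sort loU (enum (f @: C)) = map f (sort loT (enum C)).
  move=> /subsetP sC; rewrite -[RHS](_ : sort loU (map f (enum C)) = _); last first.
    rewrite sort_map; congr (map f (sort _ _)).
    by apply: funext => a; apply: funext => b; rewrite lof.
  have sub : {subset enum (f @: C) <= At} by move=> x; rewrite mem_enum; apply: sC.
  apply/perm_sort_inP.
  - exact: sub_in2 tot.
  - exact: sub_in3 trans.
  - exact: sub_in2 anti.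
  apply: uniq_perm; rewrite ?enum_uniq ?map_inj_uniq ?enum_uniq // => x.
  rewrite mem_enum; apply/imsetP/mapP => -[y yC ->]; exists y => //.
    by rewrite mem_enum.
  by rewrite mem_enum in yC.
by rewrite !sortE // -map_cat sorting_sign_map.
Qed.
End SignTransport.

Local Open Scope ring_scope.

Section OSTheory.
Context {d : Order.disp_t} {P : finBPOrderType d} (lo : rel P).

Lemma OS_relE x : OS_rel lo x -> quot_pi (OS_proper lo) x = 0.
Proof.
move=> Rx; rewrite -(rmorph0 (quot_pi _)); apply/quot_piP; rewrite subr0.
exact: gen_ideal_gen.
Qed.

Lemma e_val (a : Ipos P) : e_ (val a) = e_gen a.
Proof. by rewrite /e_ valK. Qed.

Lemma e_out (b : Spos P) : ~~ (indep b && (b != S0)) -> e_ b = 0.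
Proof. by move=> nb; rewrite /e_ insubN. Qed.

End OSTheory.

Section Restriction.
Context {dP dQ : Order.disp_t} {P : finBPOrderType dP} {Q : finBPOrderType dQ}.
Variables (loP : rel P) (loQ : rel Q) (i : Q -> P).

(* Meant for the inclusion i of an order ideal Q of P: e_alpha is kept when
   alpha comes from I(Q), and killed otherwise. *)
Definition restr_gen (a : Ipos P) : OS loQ :=
  if [pick b : Ipos Q | emb_pair i (val (val b)) == val (val a)] is Some b
  then OS_gen loQ b else 0.

Definition OS_restr : OS loP -> OS loQ := quot_lift (gc_lift restr_gen).

Hypothesis i_mono : {mono i : x y / (x <= y)%O}.
Hypothesis i_down : forall p q, (p <= i q)%O -> exists q', i q' = p.
Hypothesis rP : ranked P.
Hypothesis loPP : linear_order_on (atoms P) loP.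
Hypothesis loE : forall a b, loQ a b = loP (i a) (i b).
Hypothesis delU : forall w b b' : Spos P,
  (b <= w)%O -> (b' <= w)%O -> atS b = atS b' -> b = b'.
Hypothesis closure : forall (z w b : Spos P) a,
  circuit z -> (z <= w)%O -> a \in atS z -> (b <= w)%O ->
  atS b = atS w :\ a -> (val b).1 = (val w).1.

Let iS : Spos Q -> Spos P := embS i_mono i_down rP.
Let iS_mono : {mono iS : a b / (a <= b)%O} := embS_mono i_mono i_down rP.
Let iS_down (b : Spos P) a : (b <= iS a)%O -> exists a', iS a' = b.
Proof. exact: embS_down. Qed.
Let iS_inj : injective iS := emb_inj iS_mono.
Let iSin (b : Spos P) : (val b).1 \in codom i -> exists a, b = iS a.
Proof. by rewrite -(embS_codom i_mono i_down rP) => /codomP. Qed.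
Local Notation piQ := (quot_pi (OS_proper loQ)).

Let atS_iS b : atS (iS b) = i @: atS b. Proof. by []. Qed.
Let iS_indep b : indep (iS b) = indep b. Proof. exact: embS_indep. Qed.
Let iS0 : iS S0 = S0. Proof. exact: embS0. Qed.
Let iS_ind b : (indep (iS b) && (iS b != S0)) = (indep b && (b != S0)).
Proof.
by rewrite iS_indep -(embS0 i_mono i_down rP) (inj_eq iS_inj).
Qed.

Let restr_gen_in (a : Ipos P) (b : Ipos Q) : val a = iS (val b) -> restr_gen a = OS_gen loQ b.
Proof.
move=> e; rewrite /restr_gen; case: pickP => [c /eqP|/(_ b)]; rewrite e /=.
  move=> e'; congr OS_gen; apply: val_inj; apply: iS_inj; apply: val_inj.
  by rewrite /= e'.
by rewrite eqxx.
Qed.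

Let restrP (a : Ipos P) : (exists2 b : Ipos Q, val a = iS (val b) & restr_gen a = OS_gen loQ b) \/
  ((val (val a)).1 \notin codom i /\ restr_gen a = 0).
Proof.
have [/iSin[b e]|out] := boolP ((val (val a)).1 \in codom i).
  have bI : indep b && (b != S0) by rewrite -iS_ind -e; apply: (valP a).
  by left; exists (Sub b bI) => //; apply: restr_gen_in.
right; split=> //; rewrite /restr_gen; case: pickP => // b /eqP e.
by case/negP: out; rewrite -e /= codom_f.
Qed.

Let Ideg_iS (a : Ipos P) (b : Ipos Q) : val a = iS (val b) -> Ideg a = Ideg b.
Proof.
move=> e; rewrite /Ideg e atS_iS card_imset //; exact: emb_inj i_mono.
Qed.

Let restr_genC a b : restr_gen a * restr_gen b =
  (-1) ^+ (Ideg a * Ideg b) *: (restr_gen b * restr_gen a).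
Proof.
have [[a' ea ->]|[_ ->]] := restrP a; last by rewrite mul0r mulr0 scaler0.
have [[b' eb ->]|[_ ->]] := restrP b; last by rewrite mul0r mulr0 scaler0.
rewrite (Ideg_iS ea) (Ideg_iS eb) -!(rmorphM piQ) -linearZ; congr piQ.
exact: gcP.
Qed.

Let restr_free_mor : exists g : {additive Ealg P -> OS loQ},
  [/\ g =1 gc_lift restr_gen, monoid_morphism g, scalable g
    & forall a, g (e_gen a) = restr_gen a].
Proof.
have fB := gc_lift_zmod restr_genC.
pose F := GRing.isZmodMorphism.Build _ _ _ fB.
pose g : {additive Ealg P -> OS loQ} := HB.pack (gc_lift (deg := @Ideg _ P) restr_gen) F.
exists g; split=> //; first exact: (gc_lift_monoid restr_genC).
  exact: rat_linear.
by move=> a; apply: gc_lift_gen restr_genC _.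
Qed.

Let restr_free_rel x : OS_rel loP x -> gc_lift restr_gen x = 0.
Proof.
have [g [<- [_ gM] gZ ge]] := restr_free_mor.
have gin b : g (e_ (iS b)) = piQ (e_ b).
  have [bI|bI] := boolP (indep b && (b != S0)); last first.
    by rewrite !e_out ?iS_ind // !raddf0.
  have aI : indep (iS b) && (iS b != S0) by rewrite iS_ind.
  pose b' : Ipos Q := Sub b bI; pose a' : Ipos P := Sub (iS b) aI.
  rewrite -[iS b]/(val a') -[X in piQ (e_ X)]/(val b') !e_val ge.
  exact: restr_gen_in.
have gout (b : Spos P) : (val b).1 \notin codom i -> g (e_ b) = 0.
  move=> nb; have [bI|/e_out->] := boolP (indep b && (b != S0)); last exact: raddf0.
  rewrite -[b]/(val (Sub b bI : Ipos P)) e_val ge.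
  have [[b' /= e _]|[]//] := restrP (Sub b bI : Ipos P).
  by case/negP: nb; rewrite e; apply: codom_f.
have gout2 (b c : Spos P) : (val b).1 \notin codom i -> (b <= c)%O -> g (e_ c) = 0.
  move=> nb bc; apply: gout; apply: contra nb => /codomP[q e].
  move: bc; rewrite leSE e => /andP[/i_down[q' <-] _]; exact: codom_f.
have gsum (p : pred (Spos P)) : \sum_(c | p c) g (e_ c) =
    \sum_(c | p (iS c)) piQ (e_ c).
  rewrite (bigID (fun c => c \in codom iS)) /= addrC big1 ?add0r => [|c]; last first.
    by move=> /andP[_ nc]; apply: gout; rewrite -(embS_codom i_mono i_down rP).
  rewrite (eq_bigl (fun c => (c \in iS @: [set: Spos Q]) && p c)).
    rewrite big_imset_cond /=; last by move=> ? ? _ _; apply: iS_inj.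
    by apply: eq_big => [c|c _]; rewrite ?in_setT ?gin.
  move=> c; rewrite andbC; congr andb; apply/codomP/imsetP => -[a].
    by exists a.
  by exists a.
have set2E a b : [set iS a; iS b] = iS @: [set a; b] by rewrite imsetU1 imset_set1.
have atP (b : Spos P) : atS b \subset atoms P by case: (SposP b).
case=> {x} [a b ab|a b ab|z w zw].
- rewrite gM !ge.
  have [[a' ea ->]|[_ ->]] := restrP a; last by rewrite mul0r.
  have [[b' eb ->]|[_ ->]] := restrP b; last by rewrite mulr0.
  rewrite -(rmorphM piQ); apply/OS_relE/OS_rel_meet; apply: contraNneq ab => ab.
  by rewrite ea eb (emb_meets iS_mono iS_down) ab imset_set1 iS0.
- rewrite raddfB gM gZ !ge raddf_sum.
  rewrite (gsum (fun c => (c \in joins [set val a; val b]) && indep c)).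
  have [[a' ea ->]|[na ->]] := restrP a; last first.
    rewrite mul0r big1 ?scaler0 ?subr0 // => c /andP[cj _]; rewrite -gin.
    apply: (gout2 _ _ na); case/joinsP: cj; rewrite upper_bound2.
    by case/andP.
  have [[b' eb ->]|[nb ->]] := restrP b; last first.
    rewrite mulr0 big1 ?scaler0 ?subr0 // => c /andP[cj _]; rewrite -gin.
    apply: (gout2 _ _ nb); case/joinsP: cj; rewrite upper_bound2.
    by case/andP.
  rewrite ea eb !atS_iS (sgn_imset (loT := loQ) (emb_inj i_mono) loE loPP);
    rewrite -?atS_iS -?ea -?eb //.
  have pE c : (iS c \in joins [set val a; val b]) && indep (iS c) =
      (c \in joins [set val a'; val b']) && indep c.
    by rewrite ea eb set2E (emb_joins iS_mono iS_down) iS_indep.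
  rewrite (eq_bigl _ _ pE) -(rmorphM piQ) -linear_sum -linearZ -linearB.
  apply/OS_relE/OS_rel_join; apply: (imset_inj iS_inj).
  by rewrite -(emb_meets iS_mono iS_down) -ea -eb ab imset_set1 iS0.
rewrite raddf_sum /=.
have [/iSin[w' ew]|nw] := boolP ((val w).1 \in codom i).
  subst w; have [z' ez zw'] := embS_unicircular zw; subst z.
  have := OS_relE (OS_rel_circuit loQ zw'); rewrite linear_sum /= => E0; apply: etrans E0.
  rewrite atS_iS  big_imset /=; last by move=> ? ? _ _; apply: emb_inj.
  apply: eq_bigr => a az; rewrite gZ linearZ /=.
  have delE : delS (iS w') (i a) = iS (delS w' a).
    by apply: embS_del => b b'; apply: delU.
  rewrite delE gin atS_iS -[[set i a]]imset_set1.
  rewrite (sgn_imset (loT := loQ) (emb_inj i_mono) loE loPP) //.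
    rewrite imset_set1 sub1set; apply: (subsetP (atP (iS z'))).
    by rewrite atS_iS imset_f.
  by rewrite -atS_iS; apply: atP.
rewrite big1 // => a az; rewrite gZ gout ?scaler0 //.
rewrite /delS; case: pickP => [b /andP[bw /eqP be]|_] //=.
case/and3P: zw => cz zw _.
by rewrite (closure cz zw az bw be).
Qed.

Lemma OS_restr_zmod : zmod_morphism OS_restr.
Proof.
by case: (quot_lift_hom (OS_proper loP) (gc_lift_zmod restr_genC)
  (gc_lift_monoid restr_genC) restr_free_rel).
Qed.

Lemma OS_restr_monoid : monoid_morphism OS_restr.
Proof.
by case: (quot_lift_hom (OS_proper loP) (gc_lift_zmod restr_genC)
  (gc_lift_monoid restr_genC) restr_free_rel).
Qed.

Lemma OS_restr_gen a : OS_restr (OS_gen loP a) = restr_gen a.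
Proof.
rewrite /OS_restr (quot_liftE (OS_proper loP) (gc_lift_zmod restr_genC)
  (gc_lift_monoid restr_genC) restr_free_rel).
exact: gc_lift_gen restr_genC _.
Qed.

End Restriction.

Arguments restr_gen {dP dQ P Q} loQ i.
Arguments OS_restr {dP dQ P Q} loP loQ i.

Section DownRestriction.
Context {d : Order.disp_t} {P : finBPOrderType d} (lo : rel P).

Definition down_ord (x : P) : rel (down x) := fun a b => lo (val a) (val b).

Definition OSx (x : P) := OS (@down_ord x).
HB.instance Definition _ (x : P) := GRing.Algebra.on (OSx x).

(* r^x_y *)
Definition OS_res (x y : P) (le_yx : (y <= x)%O) : OSx x -> OSx y :=
  OS_restr (@down_ord x) (@down_ord y) (down_incl le_yx).

Hypothesis lo_lin : linear_order_on (atoms P) lo.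
Hypothesis lgP : locally_geometric P.

Lemma down_ord_linear x : linear_order_on (atoms (down x)) (@down_ord x).
Proof.
have vm : {mono (val : down x -> P) : a b / (a <= b)%O} by [].
have vd (p : P) (q : down x) : (p <= val q)%O -> exists q' : down x, val q' = p.
  by move=> pq; exists (Sub p (le_trans pq (valP q))).
have at_val (a : down x) : a \in atoms (down x) -> val a \in atoms P.
  by rewrite (emb_atoms vm vd lgP.1).
have [refl anti trans tot] := lo_lin; rewrite /down_ord; split.
- by move=> a /at_val; apply: refl.
- by move=> a b /at_val aP /at_val bP /(anti _ _ aP bP) /val_inj.
- by move=> b a c /at_val bP /at_val aP /at_val cP; apply: trans.
- by move=> a b /at_val aP /at_val bP; apply: tot.
Qed.

Section Res.
Variables (x y : P) (le_yx : (y <= x)%O).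
Let geo := lgP.2 x.
Let rx : ranked (down x). Proof. by case: geo. Qed.
Let im : {mono down_incl le_yx : a b / (a <= b)%O}. Proof. by []. Qed.
Let idown (p : down x) (q : down y) :
  (p <= down_incl le_yx q)%O -> exists q' : down y, down_incl le_yx q' = p.
Proof.
move=> pq; exists (Sub (val p) (le_trans (pq : (val p <= val q)%O) (valP q))).
exact: val_inj.
Qed.
Let loE a b : @down_ord y a b = @down_ord x (down_incl le_yx a) (down_incl le_yx b).
Proof. by []. Qed.

Lemma OS_res_zmod : zmod_morphism (OS_res le_yx).
Proof.
exact: (OS_restr_zmod im idown rx (down_ord_linear x) loE
  (@geo_del_unique _ _ geo) (@geo_circuit_closure _ _ geo)).
Qed.

Lemma OS_res_monoid : monoid_morphism (OS_res le_yx).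
Proof.
exact: (OS_restr_monoid im idown rx (down_ord_linear x) loE
  (@geo_del_unique _ _ geo) (@geo_circuit_closure _ _ geo)).
Qed.

Lemma OS_res_scalable : scalable (OS_res le_yx).
Proof. exact: rat_linear OS_res_zmod. Qed.

Lemma OS_res_gen a : OS_res le_yx (OS_gen _ a) = restr_gen _ (down_incl le_yx) a.
Proof.
exact: (OS_restr_gen im idown rx (down_ord_linear x) loE
  (@geo_del_unique _ _ geo) (@geo_circuit_closure _ _ geo)).
Qed.
End Res.
End DownRestriction.

Section Sections.
Context {d : Order.disp_t} {P : finBPOrderType d} {lo : rel P}.

Record osection (U : {set P}) := OSection {
  sec_val :> forall x, x \in U -> OSx lo x;
  sec_compat : forall x y (xU : x \in U) (yU : y \in U) (le_yx : (y <= x)%O),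
    OS_res le_yx (sec_val xU) = sec_val yU }.

Lemma osectionP (U : {set P}) (s t : osection U) :
  (forall x (xU : x \in U), s x xU = t x xU) -> s = t.
Proof.
case: s t => [s sP] [t tP] /= st.
have {}st : s = t by apply: functional_extensionality_dep => x;
  apply: functional_extensionality_dep => xU.
by subst t; congr OSection; apply: Prop_irrelevance.
Qed.

Hypothesis lo_lin : linear_order_on (atoms P) lo.
Hypothesis lgP : locally_geometric P.

(* The linear order and the local geometry are what makes the pointwise
   operations preserve compatible families. *)
Definition OSsheaf of linear_order_on (atoms P) lo & locally_geometric P :=
  osection.

Section Operations.
Variable U : {set P}.
Local Notation F := (OSsheaf lo_lin lgP U).
HB.instance Definition _ := gen_eqMixin F.
HB.instance Definition _ := gen_choiceMixin F.

Let rB {x y} (h : (y <= x)%O) : {morph OS_res (lo := lo) h : a b / a - b}.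
Proof. exact: OS_res_zmod. Qed.
Let r0 {x y} (h : (y <= x)%O) : OS_res (lo := lo) h 0 = 0.
Proof. by rewrite -[X in OS_res _ X](subrr 0) rB subrr. Qed.
Let rN {x y} (h : (y <= x)%O) : {morph OS_res (lo := lo) h : a / - a}.
Proof. by move=> a; rewrite -sub0r rB r0 sub0r. Qed.
Let rD {x y} (h : (y <= x)%O) : {morph OS_res (lo := lo) h : a b / a + b}.
Proof. by move=> a b; rewrite -[b in LHS]opprK rB rN opprK. Qed.
Let r1 {x y} (h : (y <= x)%O) : OS_res (lo := lo) h 1 = 1.
Proof. by have [] := OS_res_monoid lo_lin lgP h. Qed.
Let rM {x y} (h : (y <= x)%O) : {morph OS_res (lo := lo) h : a b / a * b}.
Proof. by have [] := OS_res_monoid lo_lin lgP h. Qed.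
Let rZ {x y} (h : (y <= x)%O) : scalable (OS_res (lo := lo) h).
Proof. exact: OS_res_scalable. Qed.

Definition sec0 : F.
Proof. by exists (fun x _ => 0) => x y _ _ h; rewrite r0. Defined.
Definition sec1 : F.
Proof. by exists (fun x _ => 1) => x y _ _ h; rewrite r1. Defined.
Definition sec_opp (s : F) : F.
Proof.
by exists (fun x xU => - s x xU) => x y xU yU h; rewrite rN (sec_compat s xU yU).
Defined.
Definition sec_add (s t : F) : F.
Proof.
exists (fun x xU => s x xU + t x xU) => x y xU yU h.
by rewrite rD (sec_compat s xU yU) (sec_compat t xU yU).
Defined.
Definition sec_mul (s t : F) : F.
Proof.
exists (fun x xU => s x xU * t x xU) => x y xU yU h.
by rewrite rM (sec_compat s xU yU) (sec_compat t xU yU).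
Defined.
Definition sec_scale (k : rat) (s : F) : F.
Proof.
exists (fun x xU => k *: s x xU) => x y xU yU h.
exact: etrans (rZ h k _) (congr1 _ (sec_compat s xU yU h)).
Defined.

Fact sec_addA : associative sec_add.
Proof. by move=> r s t; apply: osectionP => x xU; apply: addrA. Qed.
Fact sec_addC : commutative sec_add.
Proof. by move=> s t; apply: osectionP => x xU; apply: addrC. Qed.
Fact sec_add0 : left_id sec0 sec_add.
Proof. by move=> s; apply: osectionP => x xU; apply: add0r. Qed.
Fact sec_addN : left_inverse sec0 sec_opp sec_add.
Proof. by move=> s; apply: osectionP => x xU; apply: addNr. Qed.
HB.instance Definition _ :=
  GRing.isZmodule.Build F sec_addA sec_addC sec_add0 sec_addN.

Fact sec_mulA : associative sec_mul.
Proof. by move=> r s t; apply: osectionP => x xU; apply: mulrA. Qed.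
Fact sec_mul1 : left_id sec1 sec_mul.
Proof. by move=> s; apply: osectionP => x xU; apply: mul1r. Qed.
Fact sec_mulr1 : right_id sec1 sec_mul.
Proof. by move=> s; apply: osectionP => x xU; apply: mulr1. Qed.
Fact sec_mulDl : left_distributive sec_mul sec_add.
Proof. by move=> r s t; apply: osectionP => x xU; apply: mulrDl. Qed.
Fact sec_mulDr : right_distributive sec_mul sec_add.
Proof. by move=> r s t; apply: osectionP => x xU; apply: mulrDr. Qed.
HB.instance Definition _ :=
  GRing.Zmodule_isPzRing.Build F sec_mulA sec_mul1 sec_mulr1 sec_mulDl sec_mulDr.

Fact sec_scaleA k l s : sec_scale k (sec_scale l s) = sec_scale (k * l) s.
Proof. by apply: osectionP => x xU; apply: scalerA. Qed.
Fact sec_scale1 : left_id 1 sec_scale.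
Proof. by move=> s; apply: osectionP => x xU; apply: scale1r. Qed.
Fact sec_scaleDr : right_distributive sec_scale +%R.
Proof. by move=> k s t; apply: osectionP => x xU; apply: scalerDr. Qed.
Fact sec_scaleDl s : {morph sec_scale^~ s : k l / k + l}.
Proof. by move=> k l; apply: osectionP => x xU; apply: scalerDl. Qed.
HB.instance Definition _ :=
  GRing.Zmodule_isLmodule.Build rat F sec_scaleA sec_scale1 sec_scaleDr sec_scaleDl.

End Operations.

Section Restrict.
Variables (U V : {set P}) (VU : V \subset U).

Definition sec_res (s : OSsheaf lo_lin lgP U) : OSsheaf lo_lin lgP V :=
  OSection (sec_val := fun x (xV : x \in V) => s x (subsetP VU x xV))
    (fun x y xV yV h => sec_compat s (subsetP VU x xV) (subsetP VU y yV) h).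

Fact sec_res_zmod : zmod_morphism sec_res.
Proof. by move=> s t; apply: osectionP. Qed.
Fact sec_res_monoid : monoid_morphism sec_res.
Proof. by split=> [|s t]; apply: osectionP. Qed.
Fact sec_res_scalable : scalable sec_res.
Proof. by move=> k s; apply: osectionP. Qed.
HB.instance Definition _ := GRing.isZmodMorphism.Build _ _ sec_res sec_res_zmod.
HB.instance Definition _ :=
  GRing.isMonoidMorphism.Build _ _ sec_res sec_res_monoid.
HB.instance Definition _ :=
  GRing.isScalable.Build rat _ _ *:%R sec_res sec_res_scalable.
End Restrict.

End Sections.

Section SheafProperties.
Context {d : Order.disp_t} {P : finPOrderType d}.

(* the open sets of the Alexandroff topology *)
Definition order_ideal (U : {set P}) :=
  forall x y : P, x \in U -> (y <= x)%O -> y \in U.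

Variables (F : {set P} -> Type)
  (res : forall U V : {set P}, V \subset U -> F U -> F V).

Definition is_sheaf :=
  forall (I : Type) (U : {set P}) (V : I -> {set P})
    (VU : forall i, V i \subset U),
    order_ideal U -> (forall i, order_ideal (V i)) ->
    (forall x, x \in U -> exists i, x \in V i) ->
  forall t : forall i, F (V i),
    (forall i j, res (subsetIl (V i) (V j)) (t i) =
                 res (subsetIr (V i) (V j)) (t j)) ->
  exists! s : F U, forall i, res (VU i) s = t i.

Definition flasque :=
  forall (U V : {set P}) (VU : V \subset U),
    order_ideal U -> order_ideal V -> forall t, exists s, res VU s = t.

End SheafProperties.

(* Main.v *)
Require Import Defs.
From HB Require Import structures.
From mathcomp Require Import all_boot all_order all_fingroup all_algebra.
From mathcomp Require Import generic_quotient boolp ring.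
From mathcomp.multinomials Require Import monalg.

Set Implicit Arguments.
Unset Strict Implicit.
Unset Printing Implicit Defensive.

Import Order.TTheory GRing.Theory Num.Theory.
Import Defs.

(** Write [ê_α] for [e_α], with [ê_α = 1] when [α] is the bottom of [S].  The
    relations of types (i) and (ii) rewrite a product of generators as a linear
    combination of generators, so the [ê_α] span [A(P)] ([OS_spanned]).

    The heart of the proof is that, for a geometric lattice [L], all linear
    relations in [A(L)] between the [ê_α], [α] independent, are combinations of the circuit
    relations (iii): a function [φ] on [S(L)] which vanishes on dependent
    elements and satisfies the circuit relations induces a linear map on [A(L)]
    ([OS_comb_relation]).  To see this, let generators act by right
    multiplication on the vector space with basis the sets [T] of atoms of [L],
    [T · e_B = ± (T ∪ B)] if [T] and [B] are disjoint and [T ∪ B] is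
    independent, and [0] otherwise.  These operators satisfy (i) and (ii), so
    it remains to check that [φ] kills every multiple of a circuit relation.
    Such a multiple is, up to sign, either a circuit relation again or a sum
    whose terms are all dependent ([row_eval_circuit]).

    In a circuit relation all terms [(x, T)] have the same [x].  Hence a
    linear relation in [A(P_{<=x})] may be cut down to its terms [(x, T)], and
    the result, being made of circuit relations only, holds in [A(P)] and in
    each [A(P_{<=y})], [x <= y] ([fiber_relation]).  Thus [A(P)] is the direct
    sum over [x] of spaces [A_x] that depend only on [P_{<=x}], and the
    restriction to [P_{<=y}] is the projection onto the sum of the [A_x],
    [x <= y].  An element of [A(P)] with vanishing restrictions is therefore
    zero ([OS_comb_local]), and a section over an order ideal [V] extends to an
    element of [A(P)]: take as component in [A_x] that of the value at [x] if
    [x] is in [V] ([OS_extend]).  The case where [V] is all of [P] gives the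
    isomorphism, and the general case gives flasqueness. *)

Local Open Scope ring_scope.

(** * Signs of shuffles *)

Section PairProduct.
Context {T : Type} (g : T -> T -> rat).

Fixpoint pair_prod (w : seq T) : rat :=
  if w is x :: w' then \prod_(y <- w') g x y * pair_prod w' else 1.

Lemma pair_prod_nth x0 (w : seq T) :
  \prod_(i < size w) \prod_(j < size w | (i < j)%N) g (nth x0 w i) (nth x0 w j) =
  pair_prod w.
Proof.
elim: w => [|x w IH] /=; first by rewrite big_ord0.
rewrite big_ord_recl /= big_mkcond big_ord_recl /= mul1r -IH; congr (_ * _).
  by rewrite (big_nth x0) big_mkord.
apply: eq_bigr => i _; rewrite big_mkcond big_ord_recl /= mul1r.
by rewrite [RHS]big_mkcond.
Qed.

Lemma pair_prod_cat (u v : seq T) :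
  pair_prod (u ++ v) =
  pair_prod u * pair_prod v * \prod_(x <- u) \prod_(y <- v) g x y.
Proof.
elim: u => [|x u IH] /=; first by rewrite big_nil mulr1 mul1r.
by rewrite IH big_cat big_cons /=; ring.
Qed.

End PairProduct.

(** The product is a Vandermonde determinant, hence alternating.  This is the
    link between the parity of a permutation, which is defined by its cycles,
    and inversions. *)
Lemma Vandermonde_perm (n : nat) (a : 'rV[rat]_n) (s : 'S_n) :
  \prod_(i < n) \prod_(j < n | (i < j)%N) (a 0 (s j) - a 0 (s i)) =
  (-1) ^+ odd_perm s * \prod_(i < n) \prod_(j < n | (i < j)%N) (a 0 j - a 0 i).
Proof.
pose b := \row_j a 0 (s j).
have -> : \prod_(i < n) \prod_(j < n | (i < j)%N) (a 0 (s j) - a 0 (s i)) =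
    \prod_(i < n) \prod_(j < n | (i < j)%N) (b 0 j - b 0 i).
  by apply: eq_bigr => i _; apply: eq_bigr => j _; rewrite !mxE.
rewrite -!det_Vandermonde (_ : Vandermonde n b = col_perm s (Vandermonde n a)).
  by rewrite col_permE det_mulmx det_perm odd_permV mulrC.
by apply/matrixP => i j; rewrite !mxE.
Qed.

Section CrossSign.
Context {T : finType} (lo : rel T).

Definition order_sign (a b : T) : rat := if lo a b then 1 else -1.

(** The closed form of [sgn A B] for disjoint [A] and [B] (see [sgn_cross]):
    every inversion of the concatenation is a pair in A × B.  Being a product,
    it is multiplicative under disjoint unions, which is what associativity
    needs. *)
Definition cross_sign (A B : {set T}) : rat :=
  \prod_(a in A) \prod_(b in B) order_sign a b.

Variable At : {set T}.
Hypothesis lo_lin : linear_order_on At lo.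
Implicit Types A B C : {set T}.

Let atr : seq T := sort lo (enum At).
(* Positions in the sorted list of all atoms turn the order into differences
   of numbers. *)
Let rk (a : T) : rat := (index a atr)%:R.

Let sorted_sort (A : {set T}) : A \subset At -> sorted lo (sort lo (enum A)).
Proof.
move=> /subsetP AAt; have [_ _ _ tot] := lo_lin.
apply: (sort_sorted_in tot).
by apply/allP => x; rewrite mem_enum; apply: AAt.
Qed.

Let rk_sgn a b : a \in At -> b \in At -> a != b ->
  Num.sg (rk b - rk a) = order_sign a b.
Proof.
have [refl anti trans tot] := lo_lin.
have lt x y : x \in At -> y \in At -> x != y -> lo x y -> (index x atr < index y atr)%N.
  move=> xA yA xy lxy; rewrite ltnNge; apply: contra xy => yx.
  have memAt z : (z \in atr) = (z \in At) by rewrite mem_sort mem_enum.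
  have lyx : lo y x.
    apply: (sorted_leq_index_in _ _ (sorted_sort (subxx At))) yx; rewrite ?memAt //.
      by move=> u v t; rewrite !memAt; apply: trans.
    by move=> u; rewrite memAt; apply: refl.
  by apply/eqP; apply: anti => //; apply/andP.
move=> aA bA ab; rewrite /order_sign; case: ifPn => lab.
  by apply/eqP; rewrite sgr_cp0 subr_gt0 ltr_nat lt.
apply/eqP; rewrite sgr_cp0 subr_lt0 ltr_nat lt // 1?eq_sym //.
by have := tot a b aA bA; rewrite (negbTE lab).
Qed.

Lemma order_signC a b : a \in At -> b \in At -> a != b ->
  order_sign a b = - order_sign b a.
Proof. by move=> aA bA ab; rewrite -!rk_sgn // 1?eq_sym // -sgrN opprB. Qed.

Let pair_sign := pair_prod (fun a b => Num.sg (rk b - rk a)).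

Let pair_sign_sorted (s : seq T) : {subset s <= At} -> uniq s -> sorted lo s ->
  pair_sign s = 1.
Proof.
have [refl anti trans tot] := lo_lin.
move=> sAt us; rewrite (sorted_pairwise_in trans); last by apply/allP.
elim: s sAt us => //= x s IH sAt /andP[xs us] /andP[/allP lx lo_s].
rewrite /pair_sign /= -/pair_sign IH // => [|y ys]; last first.
  by apply: sAt; rewrite inE ys orbT.
rewrite mulr1 big_seq big1 // => y ys.
have xy : x != y by apply: contraNneq xs => ->.
rewrite rk_sgn /order_sign ?lx //; apply: sAt; rewrite inE ?eqxx //.
by rewrite ys orbT.
Qed.

(** The Vandermonde product of the sorted word is positive, and sorting the word
    changes the product by the signature of the sorting permutation; so that
    signature is the sign of the Vandermonde product of the word. *)
Lemma sorting_sign_pairs (w : seq T) : {subset w <= At} -> uniq w ->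
  sorting_sign lo w = pair_sign w.
Proof.
move=> wAt uw; have [refl anti trans tot] := lo_lin.
case: w wAt uw => [|x0 w'] wAt uw.
  rewrite /sorting_sign /pair_sign; case: pickP => [s _|]; last first.
    by move/(_ 1%g); rewrite (size0nil (_ : size (enum 'I_0) = 0%N)) // size_enum_ord.
  by rewrite (_ : s = 1%g) ?odd_perm1 //; apply/permP => -[].
set w := x0 :: w' in wAt uw *.
rewrite (sorting_signE _ (erefl (size w)) x0).
case: pickP => [s ss|ns]; last first.
  have : perm_eq (sort lo w) (in_tuple w) by rewrite perm_sort.
  case/tuple_permP => p pE; have := ns p.
  rewrite (_ : map _ _ = sort lo w).
    by rewrite (sort_sorted_in tot) //; apply/allP.
  by rewrite pE; apply: eq_map => i; rewrite (tnth_nth x0).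
set v := map _ _ in ss.
have sv : size v = size w by rewrite size_map size_enum_ord.
have vE (i : 'I_(size w)) : nth x0 v i = nth x0 w (s i).
  by rewrite (nth_map i) ?size_enum_ord // nth_ord_enum.
have vw : {subset v <= At}.
  by move=> _ /mapP[i _ ->]; apply/wAt/mem_nth.
have uv : uniq v.
  rewrite map_inj_uniq ?enum_uniq // => i j /eqP.
  by rewrite nth_uniq // => /eqP /val_inj /perm_inj.
have := pair_sign_sorted vw uv ss; rewrite /pair_sign -(pair_prod_nth _ x0) sv.
pose a : 'rV[rat]_(size w) := \row_i rk (nth x0 w i).
have sgp (r : 'I_(size w) -> rat) :
    \prod_(i < size w) \prod_(j < size w | (i < j)%N) Num.sg (r j - r i) =
    Num.sg (\prod_(i < size w) \prod_(j < size w | (i < j)%N) (r j - r i)).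
  rewrite (big_morph _ (sgrM (R := _)) (sgr1 _)); apply: eq_bigr => i _.
  by rewrite (big_morph _ (sgrM (R := _)) (sgr1 _)).
under eq_bigr do under eq_bigr do rewrite !vE.
rewrite (sgp (fun i => rk (nth x0 w (s i)))).
have := Vandermonde_perm a s.
under eq_bigr do under eq_bigr do rewrite !mxE.
under [in RHS]eq_bigr do under eq_bigr do rewrite !mxE.
move=> ->; rewrite sgrM sgrX sgrN sgr1 -sgp -(pair_prod_nth _ x0) => E.
by rewrite -[RHS](signrMK (odd_perm s)) E mulr1.
Qed.

Lemma sgn_cross A B : A \subset At -> B \subset At -> [disjoint A & B] ->
  sgn lo A B = cross_sign A B.
Proof.
move=> AAt BAt AB; rewrite /sgn.
have sub C : C \subset At -> {subset sort lo (enum C) <= At}.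
  by move=> /subsetP CAt x; rewrite mem_sort mem_enum; apply: CAt.
have disj : [disjoint sort lo (enum A) & sort lo (enum B)].
  apply: etrans AB; apply: etrans (eq_disjoint _ _) (eq_disjoint_r _ _) => x;
    by rewrite mem_sort mem_enum.
rewrite sorting_sign_pairs; first last.
- rewrite cat_uniq !sort_uniq !enum_uniq andbT /=.
  by rewrite -disjoint_has disjoint_sym.
- by move=> x; rewrite mem_cat => /orP[]; apply: sub.
rewrite /pair_sign pair_prod_cat -/pair_sign !pair_sign_sorted ?sort_uniq ?enum_uniq
  ?sorted_sort //; try exact: sub.
rewrite !mul1r (perm_big (enum A)) /=; last by rewrite perm_sort.
rewrite big_enum /cross_sign; apply: eq_bigr => a aA.
rewrite (perm_big (enum B)) /=; last by rewrite perm_sort.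
rewrite big_enum /=; apply: eq_bigr => b bB.
rewrite rk_sgn //; first exact: (subsetP AAt); first exact: (subsetP BAt).
by apply/negP => /eqP ab; have := disjointFr AB aA; rewrite ab bB.
Qed.

Lemma cross_signUl A B C : [disjoint A & B] ->
  cross_sign (A :|: B) C = cross_sign A C * cross_sign B C.
Proof.
move=> AB; rewrite /cross_sign -bigU //=; apply: eq_bigl => a; exact: in_setU.
Qed.

Lemma cross_signUr A B C : [disjoint B & C] ->
  cross_sign A (B :|: C) = cross_sign A B * cross_sign A C.
Proof.
move=> BC; rewrite /cross_sign -big_split; apply: eq_bigr => a _.
rewrite -bigU //=; apply: eq_bigl => b; exact: in_setU.
Qed.

Lemma cross_sign0l B : cross_sign set0 B = 1.
Proof. by rewrite /cross_sign big_set0. Qed.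

Lemma cross_sign_sq A B : cross_sign A B * cross_sign A B = 1.
Proof.
rewrite /cross_sign -big_split big1 //= => a _.
rewrite -big_split big1 //= => b _; rewrite /order_sign.
by case: ifP; rewrite ?mulrNN mulr1.
Qed.

Lemma cross_signC A B : A \subset At -> B \subset At -> [disjoint A & B] ->
  cross_sign B A = (-1) ^+ (#|A| * #|B|) * cross_sign A B.
Proof.
move=> /subsetP AAt /subsetP BAt AB; rewrite /cross_sign exchange_big /=.
rewrite mulnC exprM -prodr_const -big_split /=; apply: eq_bigr => a aA.
rewrite -prodr_const -big_split; apply: eq_bigr => b bB /=.
rewrite mulN1r order_signC; [by []|exact: BAt|exact: AAt|].
by apply/negP => /eqP ab; have := disjointFr AB aA; rewrite -ab bB.
Qed.

End CrossSign.

(** * Spanning by standard generators *)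

Lemma freealg_ind (I : choiceType) (Z : freealg I -> Prop) :
  Z 1 -> (forall x y, Z x -> Z y -> Z (x + y)) ->
  (forall k x, Z x -> Z (k *: x)) ->
  (forall x i, Z x -> Z (x * free_gen i)) -> forall x, Z x.
Proof.
move=> Z1 ZD ZZ ZM x; rewrite [x]monalgE.
have Zmon (m : {fmonom I}) : Z << m >>.
  rewrite -[m]fmK; elim/last_ind: (m : seq I) => [|s i IH].
    by rewrite -fmoneE.
  rewrite (_ : << FMonom (rcons s i) >> = << FMonom s >> * free_gen i); first exact: ZM.
  rewrite /free_gen malgM_def fgmulUU mulr1; congr << _ >>; apply: val_inj.
  by rewrite /= fmM fmuE cats1.
apply: big_rec => [|m y _ Zy]; first by rewrite -(scale0r 1); apply: ZZ.
apply: ZD => //; rewrite (_ : << _ *g m >> = x@_m *: << m >>); first exact: ZZ.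
by apply/malgP => k; rewrite mcoeffZ !mcoeffU mulr_natr.
Qed.

Lemma Ealg_ind (d : Order.disp_t) (P : finBPOrderType d) (Z : Ealg P -> Prop) :
  Z 1 -> (forall x y, Z x -> Z y -> Z (x + y)) ->
  (forall k x, Z x -> Z (k *: x)) ->
  (forall x a, Z x -> Z (x * e_gen a)) -> forall x, Z x.
Proof.
move=> Z1 ZD ZZ ZM x; rewrite -[x](@quot_repr _ _ _ (@gcomm_proper _ (@Ideg d P))).
move: (repr x) => {}x; elim/freealg_ind: x => [|y z Zy Zz|k y Zy|y i Zy].
- by rewrite rmorph1.
- by rewrite rmorphD; apply: ZD.
- by rewrite linearZ; apply: ZZ.
by rewrite rmorphM; apply: ZM.
Qed.

Section StandardSums.
Context {d : Order.disp_t} {P : finBPOrderType d} (lo : rel P).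

Local Notation pi := (quot_pi (OS_proper lo)).

Let piD x y : pi (x + y) = pi x + pi y. Proof. exact: rmorphD. Qed.
Let piB x y : pi (x - y) = pi x - pi y. Proof. exact: rmorphB. Qed.
Let pi0 : pi 0 = 0. Proof. exact: raddf0. Qed.
Let pi_sum (I : finType) (p : pred I) F : pi (\sum_(i | p i) F i) = \sum_(i | p i) pi (F i).
Proof. exact: raddf_sum. Qed.
Let piM x y : pi (x * y) = pi x * pi y. Proof. exact: rmorphM. Qed.
Let piZ k x : pi (k *: x) = k *: pi x. Proof. exact: linearZ. Qed.

(** The relations only involve [e_b] for [b] above the bottom of [S]; giving the
    bottom the value [1] makes the family span. *)
Definition OS_elt (b : Spos P) : OS lo :=
  if b == S0 then 1 else pi (e_ b).

Lemma OS_elt0 : OS_elt S0 = 1. Proof. by rewrite /OS_elt eqxx. Qed.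

Lemma OS_eltE (b : Spos P) : b != S0 -> OS_elt b = pi (e_ b).
Proof. by rewrite /OS_elt => /negbTE->. Qed.

Lemma OS_elt_gen (a : Ipos P) : OS_elt (val a) = OS_gen lo a.
Proof. by case/andP: (valP a) => _ a0; rewrite OS_eltE // e_val. Qed.

Lemma OS_elt_dep (b : Spos P) : ranked P -> ~~ indep b -> OS_elt b = 0.
Proof.
move=> rP nb; have b0 : b != S0.
  by apply: contraNneq nb => ->; rewrite /indep /atS /= cards0 rank0.
by rewrite OS_eltE // e_out ?(negbTE nb) // pi0.
Qed.

Definition OS_comb (C : Spos P -> rat) : OS lo := \sum_b C b *: OS_elt b.

Lemma OS_comb_delta b : OS_elt b = OS_comb (fun c => (c == b)%:R).
Proof.
rewrite /OS_comb (bigD1 b) //= eqxx scale1r big1 ?addr0 // => c /negbTE->.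
by rewrite scale0r.
Qed.

Lemma OS_combD C D : OS_comb C + OS_comb D = OS_comb (fun b => C b + D b).
Proof. by rewrite -big_split; apply: eq_bigr => b _; rewrite scalerDl. Qed.

Lemma OS_combZ k C : k *: OS_comb C = OS_comb (fun b => k * C b).
Proof. by rewrite scaler_sumr; apply: eq_bigr => b _; rewrite scalerA. Qed.

(** The span contains [1] and is stable under right multiplication by a
    generator, because relations (i) and (ii) express the product of two
    generators linearly. *)
Lemma OS_spanned (x : OS lo) : exists C, x = OS_comb C.
Proof.
have comb_sum (I : Type) (r : seq I) (p : pred I) F :
    (forall i : I, exists C, F i = OS_comb C) ->
    exists C, \sum_(i <- r | p i) F i = OS_comb C.
  move=> H; apply: (big_rec (fun y => exists C, y = OS_comb C)) => [|i y _ [C ->]].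
    by exists (fun=> 0); rewrite /OS_comb big1 // => b _; rewrite scale0r.
  by have [D ->] := H i; exact: (ex_intro _ _ (OS_combD D C)).
rewrite -[x](@quot_repr _ _ _ (OS_proper lo)).
move: (repr x) => {}x; elim/Ealg_ind: x => [|y z [C E] [D F]|k y [C E]|y a [C E]].
- by exists (fun b => (b == S0)%:R); rewrite -OS_comb_delta OS_elt0 rmorph1.
- by rewrite piD E F; exact: (ex_intro _ _ (OS_combD C D)).
- by rewrite piZ E; exact: (ex_intro _ _ (OS_combZ k C)).
rewrite piM E /OS_comb mulr_suml; apply: (comb_sum) => b.
have [-> |b0] := eqVneq b S0.
  rewrite OS_elt0 -scalerAl mul1r -[quot_pi _ _]/(OS_gen lo a) -OS_elt_gen.
  rewrite OS_comb_delta; exact: (ex_intro _ _ (OS_combZ _ _)).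
have [bI|nbI] := boolP (indep b && (b != S0)); last first.
  exists (fun=> 0); rewrite /OS_comb big1 => [|c _]; last by rewrite scale0r.
  by rewrite OS_eltE // e_out // rmorph0 scaler0 mul0r.
rewrite -[b]/(val (Sub b bI : Ipos P)); set b' : Ipos P := Sub b bI.
rewrite OS_elt_gen -scalerAl /OS_gen -piM.
have [m|m] := eqVneq (meets [set val b'; val a]) [set S0]; last first.
  rewrite (OS_relE (OS_rel_meet lo m)) scaler0; exists (fun=> 0).
  by rewrite /OS_comb big1 // => c _; rewrite scale0r.
have /eqP := OS_relE (OS_rel_join lo m); rewrite piB subr_eq0 => /eqP ->.
rewrite piZ pi_sum scalerA scaler_sumr; apply: (comb_sum) => c.
have [->|c0] := eqVneq c S0.
  exists (fun=> 0); rewrite /OS_comb big1 => [|e _]; last by rewrite scale0r.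
  by rewrite e_out ?eqxx ?andbF // pi0 scaler0.
rewrite -(OS_eltE c0) OS_comb_delta; exact: (ex_intro _ _ (OS_combZ _ _)).
Qed.

End StandardSums.
Arguments OS_elt {d P} lo b.
Arguments OS_comb {d P} lo C.

(** * Independent sets and circuits in a geometric lattice *)

Section SposFacts.
Context {d : Order.disp_t} {P : finBPOrderType d}.
Implicit Types (b c w z : Spos P) (A T : {set P}).

Lemma Spos_ub b t : t \in atS b -> (t <= (val b).1)%O.
Proof. by have [_ /joinsP[/upper_boundP ub _]] := SposP b; apply: ub. Qed.

Lemma atS_atoms b : atS b \subset atoms P.
Proof. by have [] := SposP b. Qed.

Lemma Spos_exists T (z : P) : T \subset atoms P -> {in T, forall t, (t <= z)%O} ->
  exists2 b : Spos P, atS b = T & ((val b).1 <= z)%O.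
Proof.
move=> TP /upper_boundP Tz; have [u uT uz] := joins_below Tz.
have uS : in_S (u, T) by rewrite /in_S TP.
by exists (Sub (u, T) uS).
Qed.

Lemma Spos_sub w A : A \subset atS w -> exists2 b, (b <= w)%O & atS b = A.
Proof.
move=> Aw; have [||b bA bw] := @Spos_exists A (val w).1.
- exact: subset_trans Aw (atS_atoms w).
- by move=> t /(subsetP Aw); apply: Spos_ub.
by exists b; rewrite // leSE bw bA.
Qed.

Lemma delS_le w a : (delS w a <= w)%O /\ atS (delS w a) = atS w :\ a.
Proof.
rewrite /delS; case: pickP => [b /andP[bw /eqP be]|N] //=.
by have [b bw bA] := Spos_sub (subD1set (atS w) a); have := N b; rewrite bw bA eqxx.
Qed.

Lemma atS_eq0 b : atS b = set0 -> b = S0.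
Proof.
move=> b0; apply: Spos_eq => //=; apply/esym.
have [_ /joinsP[_]] := SposP b; apply; last exact: le0x.
by apply/upper_boundP => t; rewrite b0 inE.
Qed.

End SposFacts.

Section GeometricSpos.
Context {d : Order.disp_t} {L : finBPOrderType d}.
Hypothesis geoL : geometric_lattice L.
Let rL : ranked L. Proof. by case: geoL. Qed.
Let latL : is_lattice L. Proof. by case: geoL. Qed.
Let smL : semimodular L. Proof. by case: geoL. Qed.
Implicit Types (b c w z : Spos L).

Lemma geo_atS_inj : injective (@atS _ L).
Proof.
move=> b c e; apply: Spos_eq => //; have [_ bj] := SposP b; have [_ cj] := SposP c.
by apply: (lattice_joins_unique latL bj); rewrite e.
Qed.

Lemma geo_leS b c : (b <= c)%O = (atS b \subset atS c).
Proof.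
apply/idP/idP => [|bc]; first by rewrite leSE => /andP[].
by have [b' b'c /geo_atS_inj <-] := Spos_sub bc.
Qed.

(** By semimodularity, adjoining the atoms of [c] outside [b] raises the rank by
    at most their number; full rank of [c] leaves no room for a defect of [b]. *)
Lemma geo_indep_le b c : (b <= c)%O -> indep c -> indep b.
Proof.
rewrite geo_leS /indep => bc /eqP rc.
have [dd ddc dE] := Spos_sub (subsetDl (atS c) (atS b)).
have bc' : (b <= c)%O by rewrite geo_leS.
move: (bc') (ddc); rewrite !leSE => /andP[b1 _] /andP[d1 _].
have [|j jbd jc] := @joins_below _ _ [set (val b).1; (val dd).1] (val c).1.
  by rewrite upper_bound2 b1.
have [m mbd _] := @meets_above _ _ (val b).1 (val dd).1 \bot%O (le0x _) (le0x _).
have jE : j = (val c).1.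
  have [_ /joinsP[_]] := SposP c; apply => //; apply/upper_boundP => t tc.
  case/joinsP: jbd; rewrite upper_bound2 => /andP[bj dj] _.
  have [tb|tb] := boolP (t \in atS b); first exact: le_trans (Spos_ub tb) bj.
  by apply: le_trans (Spos_ub _) dj; rewrite dE !inE tb.
have [dat dj] := SposP dd; have [bat bj] := SposP b.
have rd := rank_join_le geoL dat dj; have rb := rank_join_le geoL bat bj.
have := leq_trans (leq_addr _ _) (smL jbd mbd); rewrite jE rc.
move=> /leq_trans/(_ (leq_add (leqnn _) rd)); rewrite dE.
rewrite -(cardsID (atS b) (atS c)) (setIidPr bc) leq_add2r => br.
by rewrite eqn_leq rb.
Qed.

(** If deleting an element of one circuit [z] makes [w] independent, then [w]
    has rank [|w| - 1].  For another circuit [z'], delete instead some [a'] in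
    [z] but not in [z']: the rank does not drop, so the result is independent
    although it contains [z']. *)
Lemma geo_unicircular z w b a :
  circuit z -> (z <= w)%O -> a \in atS z -> atS b = atS w :\ a -> indep b ->
  unicircular z w.
Proof.
move=> cz zw az bw /eqP ib; rewrite /unicircular cz zw /=.
have subZ : {subset atS z <= atS w} by apply/subsetP; rewrite -geo_leS.
have clos a' : a' \in atS z -> rank (val (delS w a')).1 = rank (val w).1.
  move=> a'z; have [le e] := delS_le w a'.
  by rewrite (geo_circuit_closure geoL cz zw a'z le e).
have cardE a' : a' \in atS z -> #|atS w| = #|atS (delS w a')|.+1.
  by move=> a'z; have [_ ->] := delS_le w a'; rewrite (cardsD1 a' (atS w)) subZ.
have rw : (rank (val w).1).+1 = #|atS w|.
  rewrite (cardE _ az) -(clos _ az); congr _.+1.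
  suff <- : b = delS w a by [].
  by apply: geo_atS_inj; have [_ ->] := delS_le w a.
apply/forallP => z'; apply/implyP => /andP[cz' z'w].
case: (boolP (atS z \subset atS z')) => [zz'|/subsetPn[a' a'z a'z']].
  rewrite -geo_leS le_eqVlt in zz'; case/orP: zz' => [/eqP->//|zz'].
  case/andP: cz' => _ /forallP/(_ z)/implyP/(_ zz'); by case/andP: cz => /negbTE->.
have [le e] := delS_le w a'.
have : indep z'.
  apply: (@geo_indep_le z' (delS w a')); last first.
    by rewrite /indep (clos _ a'z) -eqSS rw (cardE _ a'z).
  rewrite geo_leS e subsetD1 a'z' andbT -geo_leS //.
by case/andP: cz' => /negbTE->.
Qed.

End GeometricSpos.

(** * Exterior multiplication on independent sets *)

Section IndexedMatrices.
Variable X : finType.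
Variable x0 : X.

(** The matrix ring needs a dimension of the form [n.+1]; the point [x0] shows
    that [#|X|] has this form. *)
Definition mxdim := #|X|.-1.

Let mxdimE : #|X| = mxdim.+1.
Proof. by rewrite /mxdim prednK //; apply/card_gt0P; exists x0. Qed.

Definition mxval (i : 'I_mxdim.+1) : X := enum_val (cast_ord (esym mxdimE) i).
Definition mxidx (x : X) : 'I_mxdim.+1 := cast_ord mxdimE (enum_rank x).

Lemma mxidxK : cancel mxidx mxval.
Proof. by move=> x; rewrite /mxval /mxidx cast_ordK enum_rankK. Qed.
Lemma mxvalK : cancel mxval mxidx.
Proof. by move=> i; rewrite /mxval /mxidx enum_valK cast_ordKV. Qed.

Lemma sum_mxval (V : nmodType) (F : X -> V) :
  \sum_(i < mxdim.+1) F (mxval i) = \sum_x F x.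
Proof.
rewrite (reindex mxidx) /=; last by exists mxval => ? _; [exact: mxidxK|exact: mxvalK].
by apply: eq_bigr => x _; rewrite mxidxK.
Qed.

Definition mx_of (h : X -> X -> rat) : 'M[rat]_mxdim.+1 :=
  \matrix_(i, j) h (mxval i) (mxval j).

Lemma mx_ofE h x j : mx_of h (mxidx x) j = h x (mxval j).
Proof. by rewrite mxE mxidxK. Qed.

Lemma mx_of_mul h k : mx_of h * mx_of k = mx_of (fun x z => \sum_y h x y * k y z).
Proof.
apply/matrixP => i j; rewrite !mxE -(sum_mxval (fun y => h _ y * k y _)).
by apply: eq_bigr => l _; rewrite !mxE.
Qed.

Section RowEval.
Variables (V : lmodType rat) (phi : X -> V).

(** The value at the [x]-th row of [M] of the linear map which sends the basis
    vector of index [y] to [phi y]. *)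
Definition row_eval (x : X) (M : 'M[rat]_mxdim.+1) : V :=
  \sum_j M (mxidx x) j *: phi (mxval j).

Lemma row_eval_zmod x : zmod_morphism (row_eval x).
Proof.
by move=> M N; rewrite -sumrB; apply: eq_bigr => j _; rewrite !mxE scalerBl.
Qed.
HB.instance Definition _ x := GRing.isZmodMorphism.Build _ _ (row_eval x) (row_eval_zmod x).

Lemma row_evalZ x k M : row_eval x (k *: M) = k *: row_eval x M.
Proof.
by rewrite scaler_sumr; apply: eq_bigr => j _; rewrite !mxE scalerA.
Qed.

Lemma row_eval_sum x (I : finType) (p : pred I) F :
  row_eval x (\sum_(i | p i) F i) = \sum_(i | p i) row_eval x (F i).
Proof. exact: raddf_sum. Qed.

Lemma row_evalM x M N :
  row_eval x (M * N) = \sum_j M (mxidx x) j *: row_eval (mxval j) N.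
Proof.
rewrite /row_eval; under eq_bigr do rewrite mxE scaler_suml.
rewrite exchange_big; apply: eq_bigr => j _ /=; rewrite mxvalK scaler_sumr.
by apply: eq_bigr => k _; rewrite scalerA.
Qed.

Lemma row_eval_of x h : row_eval x (mx_of h) = \sum_y h x y *: phi y.
Proof.
by rewrite -sum_mxval; apply: eq_bigr => j _; rewrite mx_ofE.
Qed.

Lemma row_eval1 x : row_eval x 1 = phi x.
Proof.
rewrite /row_eval (bigD1 (mxidx x)) //= mxE eqxx scale1r mxidxK.
by rewrite big1 ?addr0 // => j; rewrite mxE eq_sym => /negbTE->; rewrite scale0r.
Qed.
End RowEval.
End IndexedMatrices.

Section ExteriorModel.
Context {d : Order.disp_t} {L : finBPOrderType d} (lo : rel L).
Hypothesis lo_lin : linear_order_on (atoms L) lo.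
Hypothesis geoL : geometric_lattice L.
Implicit Types (T U A B : {set L}).

Definition indep_set T := [exists b : Spos L, (atS b == T) && indep b].

Lemma indep_set_atS b : indep_set (atS b) = indep b.
Proof.
apply/existsP/idP => [[c /andP[/eqP/(geo_atS_inj geoL)->]]//|ib].
by exists b; rewrite eqxx.
Qed.

Lemma indep_setS T U : T \subset U -> indep_set U -> indep_set T.
Proof.
move=> TU /existsP[c /andP[/eqP cU ic]]; rewrite -cU in TU.
have [b bc <-] := Spos_sub TU.
by rewrite indep_set_atS; apply: geo_indep_le bc ic.
Qed.

Lemma indep_set_atoms T : indep_set T -> T \subset atoms L.
Proof. by move=> /existsP[b /andP[/eqP<- _]]; apply: atS_atoms. Qed.

Local Notation dimS := (mxdim {set L}).

(** Right multiplication by [e_B] on the space with basis the sets of atoms. *)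
Definition wedge B : 'M[rat]_dimS.+1 := mx_of set0 (fun T U =>
  if [&& U == T :|: B, [disjoint T & B] & indep_set U] then cross_sign lo T B else 0).

Lemma wedge_dep B : ~~ indep_set B -> wedge B = 0.
Proof.
move=> nB; apply/matrixP => i j; rewrite !mxE; case: ifP => // /and3P[/eqP-> _ iB].
by move: nB; rewrite (indep_setS _ iB) ?subsetUr.
Qed.

(** Independence of the final set [T ∪ A ∪ B] forces independence of [T ∪ A], so
    only the signs have to be compared, by multiplicativity of [cross_sign]. *)
Lemma wedgeM A B : wedge A * wedge B =
  if [disjoint A & B] then cross_sign lo A B *: wedge (A :|: B) else 0.
Proof.
rewrite mx_of_mul; apply/matrixP => i j; rewrite mxE.
set T := mxval _ i; set U := mxval _ j.
rewrite (bigD1 (T :|: A)) //= eqxx big1 ?addr0 => [|V /negbTE->]; last by rewrite mul0r.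
have -> : (if [disjoint A & B] then cross_sign lo A B *: wedge (A :|: B) else 0) i j =
    if [disjoint A & B] then cross_sign lo A B * (wedge (A :|: B) i j) else 0.
  by case: ifP; rewrite mxE.
rewrite mxE -/T -/U setUA.
have dU : [disjoint T :|: A & B] = [disjoint T & B] && [disjoint A & B].
  by rewrite -!setI_eq0 setIUl setU_eq0.
have dU' : [disjoint T & A :|: B] = [disjoint T & A] && [disjoint T & B].
  by rewrite -!setI_eq0 setIUr setU_eq0.
rewrite dU dU' /=.
have [AB|AB] := boolP [disjoint A & B]; last first.
  by rewrite andbF /= andbF mulr0.
have [TA|TA] := boolP [disjoint T & A]; last by rewrite /= !andbF mul0r mulr0.
have [TB|TB] := boolP [disjoint T & B]; last by rewrite /= !andbF !mulr0.
case: (U =P _) => [->|]; last by rewrite !mulr0.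
have [iU|iU] := boolP (indep_set (T :|: A :|: B)); last by rewrite !mulr0.
rewrite (indep_setS _ iU) ?subsetUl //= cross_signUr // cross_signUl //.
by ring.
Qed.

Lemma wedgeC A B : A \subset atoms L -> B \subset atoms L ->
  wedge A * wedge B = (-1) ^+ (#|A| * #|B|) *: (wedge B * wedge A).
Proof.
move=> Aat Bat; rewrite !wedgeM disjoint_sym.
case: ifP => [BA|]; last by rewrite scaler0.
by rewrite (cross_signC lo_lin Bat Aat) // setUC scalerA mulnC.
Qed.

Lemma row_eval_wedge (V : lmodType rat) (phi : {set L} -> V) T B :
  (forall A, ~~ indep_set A -> phi A = 0) ->
  row_eval set0 phi T (wedge B) =
  if [disjoint T & B] then cross_sign lo T B *: phi (T :|: B) else 0.
Proof.
move=> phi0; rewrite row_eval_of (bigD1 (T :|: B)) //= eqxx.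
rewrite big1 ?addr0 => [|U /negbTE->]; last by rewrite scale0r.
have [TB|TB] /= := boolP [disjoint T & B]; last by rewrite scale0r.
by case: ifPn => [//|/phi0->]; rewrite !scaler0.
Qed.

End ExteriorModel.

(** * Linear relations in the algebra of a geometric lattice *)

Section LinearRelations.
Context {d : Order.disp_t} {L : finBPOrderType d} (lo : rel L).
Hypothesis lo_lin : linear_order_on (atoms L) lo.
Hypothesis geoL : geometric_lattice L.
Implicit Types (T U A B : {set L}).

Lemma sgn_del (w : Spos L) a : a \in atS w ->
  sgn lo [set a] (atS (delS w a)) = cross_sign lo [set a] (atS w :\ a).
Proof.
move=> aw; have [_ ->] := delS_le w a; have /subsetP wat := atS_atoms w.
rewrite (sgn_cross lo_lin) ?sub1set ?wat //.
  exact: subset_trans (subD1set _ _) (atS_atoms w).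
by rewrite disjoints1 !inE eqxx.
Qed.

Variables (V : lmodType rat) (phi : Spos L -> V).
Hypothesis phi_dep : forall b, ~~ indep b -> phi b = 0.
Hypothesis phi_circuit : forall z w, unicircular z w ->
  \sum_(a in atS z) sgn lo [set a] (atS (delS w a)) *: phi (delS w a) = 0.

Definition set_phi T : V := \sum_(b | atS b == T) phi b.

Lemma set_phi_atS b : set_phi (atS b) = phi b.
Proof. by apply: big_pred1 => c; rewrite /= (inj_eq (geo_atS_inj geoL)). Qed.

Lemma set_phi_dep T : ~~ indep_set T -> set_phi T = 0.
Proof.
move=> nT; apply: big1 => b /eqP bT; apply: phi_dep.
by rewrite -(indep_set_atS geoL) bT.
Qed.

(** Left multiplication by [T] of the circuit relation of [w].  If [T] meets
    [w], a surviving term has [T ∩ w = {a}], and then its support contains the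
    circuit [z].  Otherwise the terms are, up to a common sign, those of the
    relation of [T ∪ w]; either all are dependent, or some are not and [T ∪ w]
    is again unicircular. *)
Lemma row_eval_circuit T z w : unicircular z w ->
  row_eval set0 set_phi T
    (\sum_(a in atS z) sgn lo [set a] (atS (delS w a)) *: wedge lo (atS w :\ a)) = 0.
Proof.
move=> zw; have /and3P[cz zw' _] := zw.
have zsub : {subset atS z <= atS w} by apply/subsetP; rewrite -(geo_leS geoL).
have [Tat|nTat] := boolP (T \subset atoms L); last first.
  rewrite row_eval_sum big1 // => a az; rewrite row_evalZ.
  rewrite (row_eval_wedge lo _ _ set_phi_dep).
  rewrite set_phi_dep ?scaler0 ?if_same ?scaler0 //.
  apply: contra nTat => /indep_set_atoms; apply: subset_trans; exact: subsetUl.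
have [TW|TW] := boolP [disjoint T & atS w]; last first.
  rewrite row_eval_sum big1 // => a az; rewrite row_evalZ.
  rewrite (row_eval_wedge lo _ _ set_phi_dep).
  case: ifP => Ta; last by rewrite scaler0.
  rewrite set_phi_dep ?scaler0 //; apply/negP => iT.
  have aT : a \in T.
    have /pred0Pn[t /= /andP[tT tw]] := TW.
    suff <- : t = a by [].
    by apply/eqP; have := disjointFr Ta tT; rewrite !inE tw andbT => /negbFE.
  have : indep z.
    rewrite -(indep_set_atS geoL); apply: (indep_setS geoL _ iT).
    apply/subsetP => t tz; rewrite !inE zsub // andbT.
    by case: eqP => [->|_]; rewrite ?aT ?orbT.
  by case/andP: cz => /negbTE->.
have term a : a \in atS z ->
    row_eval set0 set_phi T
      (sgn lo [set a] (atS (delS w a)) *: wedge lo (atS w :\ a)) =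
    ((-1) ^+ #|T| * cross_sign lo T (atS w)) *:
    (cross_sign lo [set a] ((T :|: atS w) :\ a) *: set_phi ((T :|: atS w) :\ a)).
  move=> az; have aw := zsub a az; have aT := disjointFl TW aw.
  have aat : [set a] \subset atoms L by rewrite sub1set (subsetP (atS_atoms w)).
  have Ta : [disjoint T & [set a]] by rewrite disjoint_sym disjoints1 aT.
  have Twa : [disjoint T & atS w :\ a].
    by apply: disjointWr TW; apply: subD1set.
  have UE : (T :|: atS w) :\ a = T :|: (atS w :\ a).
    apply/setP => t; rewrite !inE; case: eqP => //= ->.
    by rewrite aT.
  have wE : cross_sign lo T (atS w) =
      cross_sign lo T [set a] * cross_sign lo T (atS w :\ a).
    rewrite -cross_signUr ?setD1K //.
    by rewrite disjoints1 !inE eqxx.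
  rewrite row_evalZ (row_eval_wedge lo _ _ set_phi_dep) Twa UE.
  rewrite !scalerA; congr (_ *: _).
  rewrite (sgn_del aw) wE cross_signUr // (cross_signC lo_lin Tat aat Ta) cards1 muln1.
  set s := (-1) ^+ #|T|; have ss : s * s = 1 by rewrite -exprMn mulrNN mulr1 expr1n.
  have cc := cross_sign_sq lo T [set a].
  set x := cross_sign lo T [set a] in cc *; set y := cross_sign lo T _.
  set u := cross_sign lo _ _.
  transitivity ((s * s) * (x * x) * (u * y)); first by rewrite ss cc !mul1r.
  by ring.
rewrite row_eval_sum; under eq_bigr => a az do rewrite term //.
rewrite -scaler_sumr.
have [/existsP[a /andP[az /existsP[b /andP[/eqP be ib]]]]|] :=
    boolP [exists a, (a \in atS z) && indep_set ((T :|: atS w) :\ a)]; last first.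
  rewrite negb_exists => /forallP ndep.
  rewrite big1 ?scaler0 // => a az; rewrite set_phi_dep ?scaler0 //.
  by have := ndep a; rewrite az.
have [dw de] := delS_le w a.
have db : (delS w a <= b)%O.
  by rewrite (geo_leS geoL) be de; apply: setSD; apply: subsetUr.
have wb : ((val w).1 <= (val b).1)%O.
  rewrite -(geo_circuit_closure geoL cz zw' az dw de).
  by move: db; rewrite leSE => /andP[].
have [|t|w' w'E _] := @Spos_exists _ _ (T :|: atS w) (val b).1.
- by rewrite subUset Tat atS_atoms.
- rewrite inE => /orP[tT|tw]; last exact: le_trans (Spos_ub tw) wb.
  apply: Spos_ub; rewrite be !inE tT andbT.
  by apply: contraTneq az => ta; apply: contraTN tT => /zsub; rewrite -ta => /(disjointFl TW)->.
have zw'' : (z <= w')%O by rewrite (geo_leS geoL) w'E; apply/subsetP => t /zsub; rewrite inE orbC => ->.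
have uz : unicircular z w'.
  by apply: (geo_unicircular geoL cz zw'' az _ ib); rewrite w'E.
rewrite (eq_bigr (fun a => sgn lo [set a] (atS (delS w' a)) *: phi (delS w' a))).
  by rewrite phi_circuit // scaler0.
move=> a' a'z; rewrite sgn_del; last by rewrite w'E inE zsub // orbT.
by rewrite -set_phi_atS; have [_ ->] := delS_le w' a'; rewrite w'E.
Qed.

Local Notation dimS := (mxdim {set L}).

Let wedge_gen (a : Ipos L) := wedge lo (atS (val a)).

Let wedge_genC (a b : Ipos L) : wedge_gen a * wedge_gen b =
  (-1) ^+ (Ideg a * Ideg b) *: (wedge_gen b * wedge_gen a).
Proof. by apply: wedgeC => //; apply: atS_atoms. Qed.

(* The wedge operators commute in the graded sense, so they define a
   representation of the free graded-commutative algebra. *)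
Let model_mor : exists g : {additive Ealg L -> 'M[rat]_dimS.+1},
  [/\ monoid_morphism g, scalable g
    & forall b, b != S0 -> g (e_ b) = wedge lo (atS b)].
Proof.
have fB := gc_lift_zmod wedge_genC; pose F := GRing.isZmodMorphism.Build _ _ _ fB.
pose g : {additive Ealg L -> 'M[rat]_dimS.+1} :=
  HB.pack (gc_lift (deg := @Ideg _ L) wedge_gen) F.
exists g; split; first exact: (gc_lift_monoid wedge_genC).
  exact: rat_linear.
move=> b b0; have [ib|nib] := boolP (indep b).
  have bI : indep b && (b != S0) by rewrite ib.
  rewrite -[b]/(val (Sub b bI : Ipos L)) e_val.
  exact: gc_lift_gen wedge_genC _.
rewrite e_out ?(negbTE nib) // raddf0 wedge_dep ?(indep_set_atS geoL) //.
Qed.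

Lemma disjoint_meets (a b : Spos L) :
  (meets [set a; b] == [set S0]) = [disjoint atS a & atS b].
Proof.
apply/eqP/idP => [ab|ab].
  apply/pred0P => t /=; apply/negP => /andP[ta tb].
  have ta1 : [set t] \subset atS a by rewrite sub1set.
  have [c ca cE] := Spos_sub ta1.
  have cb : (c <= b)%O by rewrite (geo_leS geoL) cE sub1set.
  have [m mab cm] := meets_above ca cb.
  move: mab cm; rewrite ab in_set1 => /eqP->; rewrite (geo_leS geoL) cE sub1set.
  by rewrite inE.
apply/setP => m; rewrite [RHS]in_set1; apply/meetsP/eqP => [[+ _]|->].
  rewrite lower_bound2 !(geo_leS geoL) -subsetI.
  by move: ab; rewrite -setI_eq0 => /eqP->; rewrite subset0 => /eqP/atS_eq0.
have S0le (w : Spos L) : (S0 <= w)%O by rewrite (geo_leS geoL) sub0set.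
rewrite lower_bound2 !S0le; split=> // w; rewrite lower_bound2 !(geo_leS geoL) -subsetI.
by move: ab; rewrite -setI_eq0 => /eqP->; rewrite subset0 => /eqP/atS_eq0.
Qed.

Lemma joins_atS (a b c : Spos L) :
  (c \in joins [set a; b]) = (atS c == atS a :|: atS b).
Proof.
apply/joinsP/eqP => [[]|cE].
  rewrite upper_bound2 !(geo_leS geoL) -subUset => abc cmin.
  have [e ec eE] := Spos_sub abc; rewrite -eE (cmin e) //.
  by rewrite upper_bound2 !(geo_leS geoL) eE subsetUl subsetUr.
rewrite upper_bound2 !(geo_leS geoL) cE subsetUl subsetUr; split=> // w.
rewrite upper_bound2 !(geo_leS geoL) -subUset cE => abw wab.
by apply: (geo_atS_inj geoL); apply/eqP; rewrite eqEsubset cE wab.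
Qed.

Let model_meet_join (g : {additive Ealg L -> 'M[rat]_dimS.+1}) :
  monoid_morphism g -> scalable g ->
  (forall b, b != S0 -> g (e_ b) = wedge lo (atS b)) ->
  forall a b : Ipos L,
  g (e_gen a * e_gen b) =
  (if [disjoint atS (val a) & atS (val b)] then
     g (sgn lo (atS (val a)) (atS (val b))
        *: \sum_(c in joins [set val a; val b] | indep c) e_ c) else 0).
Proof.
move=> [_ gM] gZ ge a b.
have g_gen (x : Ipos L) : g (e_gen x) = wedge lo (atS (val x)).
  by rewrite -e_val ge //; case/andP: (valP x).
rewrite gM !g_gen wedgeM //; case: ifP => // ab.
rewrite (sgn_cross lo_lin) ?atS_atoms // gZ; congr (_ *: _).
rewrite raddf_sum /=.
have [/existsP[c /andP[/eqP cE ic]]|nind] := boolP (indep_set (atS (val a) :|: atS (val b))).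
  rewrite (big_pred1 c) => [|e]; last first.
    rewrite /= joins_atS -cE (inj_eq (geo_atS_inj geoL)).
    by case: eqP => // ->; rewrite ic.
  rewrite ge ?cE //; apply/eqP => c0; have /andP[_ /eqP[]] := valP a.
  apply: atS_eq0; apply/eqP; rewrite -subset0 (_ : set0 = atS c); last by rewrite c0.
  by rewrite cE subsetUl.
rewrite wedge_dep // big1 // => c /andP[]; rewrite joins_atS => /eqP cE ic.
by move: nind; rewrite -cE (indep_set_atS geoL) ic.
Qed.

(** The elements [u] of the free algebra such that [phi] kills [T · (u * v)] for
    all [T] and [v] form a two-sided ideal containing the relations: [phi] kills
    [T · u] for a circuit relation [u], and [u] commutes with generators up to
    sign, so that [v] can be moved to its left. *)
Lemma OS_comb_relation (c : Spos L -> rat) :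
  OS_comb lo c = 0 -> \sum_b c b *: phi b = 0.
Proof.
have [g [gmon gZ ge]] := model_mor; have [g1 gM] := gmon.
have gmj := model_meet_join gmon gZ ge.
pose e' (b : Spos L) : Ealg L := if b == S0 then 1 else e_ b.
pose ev := row_eval (set0 : {set L}) set_phi.
have evE b : ev set0 (g (e' b)) = phi b.
  rewrite /e'; have [->|b0] := eqVneq b S0.
    by rewrite g1 /ev row_eval1 -[set0]/(atS (S0 : Spos L)) set_phi_atS.
  rewrite ge // /ev (row_eval_wedge lo _ _ set_phi_dep) -setI_eq0 set0I eqxx.
  by rewrite cross_sign0l scale1r set0U set_phi_atS.
have -> : OS_comb lo c = quot_pi (OS_proper lo) (\sum_b c b *: e' b).
  apply/esym/(etrans (raddf_sum (quot_pi (OS_proper lo)) _ _ _)).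
  apply: eq_bigr => b _; apply: etrans (quot_pi_scalable _ _ _) _.
  congr (_ *: _); rewrite /OS_elt /e'; case: ifP => // _.
have ev_sum : \sum_b c b *: phi b = ev set0 (g (\sum_b c b *: e' b)).
  rewrite raddf_sum /ev row_eval_sum; apply: eq_bigr => b _.
  by rewrite gZ row_evalZ -/ev evE.
rewrite ev_sum -[X in _ = X -> _](rmorph0 (quot_pi (OS_proper lo))) => /quot_piP.
rewrite subr0; set u := (X in gen_ideal _ X) => uJ.
suff H : forall T v, ev T (g u * g v) = 0 by rewrite -[g u]mulr1 -g1.
apply: (uJ (fun u => forall T v, ev T (g u * g v) = 0)) => [|y].
  split=> [T v|x y Ix Iy T v|a x Ix]; first by rewrite raddf0 mul0r /ev raddf0.
    by rewrite raddfB mulrBl /ev raddfB /= -/ev Ix Iy subrr.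
  split=> T v; last by rewrite gM -mulrA -gM.
  rewrite gM -mulrA /ev row_evalM big1 // => j _.
  by rewrite -/ev Ix scaler0.
case=> {y} [a b ab|a b ab|z w zw] T v.
- have {}ab : [disjoint atS (val a) & atS (val b)] = false.
    by apply/negbTE; apply: contra ab; rewrite -disjoint_meets.
  by rewrite gmj ab mul0r /ev raddf0.
- have {}ab : [disjoint atS (val a) & atS (val b)].
    by rewrite -disjoint_meets; apply/eqP.
  by rewrite raddfB gmj ab subrr mul0r /ev raddf0.
pose gw := \sum_(a in atS z) sgn lo [set a] (atS (delS w a)) *: wedge lo (atS w :\ a).
have dS a : atS (delS w a) = atS w :\ a by case: (delS_le w a).
have zsub : {subset atS z <= atS w}.
  by apply/subsetP; rewrite -(geo_leS geoL); case/and3P: zw.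
have -> : g (\sum_(a in atS z) sgn lo [set a] (atS (delS w a)) *: e_ (delS w a)) = gw.
  rewrite raddf_sum; apply: eq_bigr => a az; rewrite gZ ge ?dS //.
  (* If w :\ a were empty, the join of w would be the bottom, by closure, though
     it lies above the atom a. *)
  apply/eqP => d0; have cz : circuit z by case/and3P: zw.
  have zw' : (z <= w)%O by case/and3P: zw.
  have [dw dE] := delS_le w a.
  have := geo_circuit_closure geoL cz zw' az dw dE; rewrite d0 /= => w0.
  have [rL _ _ _] := geoL; have := rank_homo rL (Spos_ub (zsub _ az)).
  have := subsetP (atS_atoms z) _ az; rewrite inE => /eqP->.
  by rewrite -w0 rank0.
(* All terms of gw have the same degree, so moving a generator across gw
   produces a single sign. *)
have comm : exists M, gw * g v = M * gw.
  have gwC (a : Ipos L) : exists k, gw * g (e_gen a) = k *: (g (e_gen a) * gw).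
    exists ((-1) ^+ (#|atS w|.-1 * #|atS (val a)|)).
    rewrite -e_val ge; last by case/andP: (valP a).
    rewrite mulr_suml mulr_sumr scaler_sumr; apply: eq_bigr => x xz.
    rewrite -scalerAl wedgeC ?atS_atoms //; last first.
      exact: subset_trans (subD1set _ _) (atS_atoms w).
    rewrite -scalerAr !scalerA mulrC; congr (_ * _ *: _).
    by rewrite (cardsD1 x (atS w)) zsub.
  elim/Ealg_ind: v => [|x y [M EM] [N EN]|k x [M EM]|x a [M EM]].
  - by exists 1; rewrite g1 mulr1 mul1r.
  - by exists (M + N); rewrite raddfD mulrDr EM EN mulrDl.
  - by exists (k *: M); rewrite gZ -scalerAr EM scalerAl.
  have [k E] := gwC a; exists (k *: (M * g (e_gen a))).
  by rewrite gM mulrA EM -mulrA E -scalerAr -scalerAl mulrA.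
have [M ->] := comm; rewrite /ev row_evalM big1 // => j _.
by rewrite row_eval_circuit // scaler0.
Qed.

End LinearRelations.

(** * Restriction to an order ideal *)

Section IdealTransport.
Context {dP dQ : Order.disp_t} {P : finBPOrderType dP} {Q : finBPOrderType dQ}.
Variables (loP : rel P) (loQ : rel Q) (i : Q -> P).
Hypothesis i_mono : {mono i : x y / (x <= y)%O}.
Hypothesis i_down : forall p q, (p <= i q)%O -> exists q', i q' = p.
Hypothesis rP : ranked P.
Hypothesis loPP : linear_order_on (atoms P) loP.
Hypothesis loE : forall a b, loQ a b = loP (i a) (i b).
Hypothesis delU : forall w b b' : Spos P,
  (b <= w)%O -> (b' <= w)%O -> atS b = atS b' -> b = b'.
Hypothesis closure : forall (z w b : Spos P) a,
  circuit z -> (z <= w)%O -> a \in atS z -> (b <= w)%O ->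
  atS b = atS w :\ a -> (val b).1 = (val w).1.

Let iS : Spos Q -> Spos P := embS i_mono i_down rP.
Let iS_inj : injective iS := emb_inj (embS_mono i_mono i_down rP).

Lemma sum_embS_fiber (V : nmodType) (F : Spos P -> V) (t : Q) :
  \sum_(b | (val b).1 == i t) F b = \sum_(b | (val b).1 == t) F (iS b).
Proof.
rewrite (eq_bigl [in iS @: [set b | (val b).1 == t]]) => [|b].
  rewrite big_imset /=; last by move=> ? ? _ _; apply: iS_inj.
  by apply: eq_bigl => b; rewrite inE.
apply/eqP/imsetP => [bt|[c]]; last first.
  by rewrite inE => /eqP ct ->; rewrite embS1 ct.
have /codomP[c bE] : b \in codom iS by rewrite embS_codom bt codom_f.
by exists c => //; rewrite inE -(inj_eq (emb_inj i_mono)) -bt bE.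
Qed.

Lemma embS_eq0 b : (iS b == S0) = (b == S0).
Proof. by rewrite -(embS0 i_mono i_down rP) (inj_eq iS_inj). Qed.

Lemma OS_restr_elt b : OS_restr loP loQ i (OS_elt loP (iS b)) = OS_elt loQ b.
Proof.
have [b0|b0] := eqVneq b S0.
  rewrite b0 /iS (embS0 i_mono i_down rP) !OS_elt0.
  by have [] := OS_restr_monoid i_mono i_down rP loPP loE delU closure.
have [ib|nib] := boolP (indep b); last first.
  have rB := OS_restr_zmod i_mono i_down rP loPP loE delU closure.
  rewrite !OS_elt_dep ?embS_indep //; last exact: emb_ranked rP.
  by rewrite -[X in OS_restr _ _ _ X](subrr 0) rB subrr.
have bI : indep b && (b != S0) by rewrite ib.
have aI : indep (iS b) && (iS b != S0) by rewrite embS_indep embS_eq0.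
rewrite -[b in RHS]/(val (Sub b bI : Ipos Q)) -[iS b]/(val (Sub (iS b) aI : Ipos P)).
rewrite !OS_elt_gen (OS_restr_gen i_mono i_down rP loPP loE delU closure).
rewrite /restr_gen; case: pickP => [c /eqP e|/(_ (Sub b bI))]; last by rewrite eqxx.
by congr OS_gen; apply/val_inj/iS_inj/val_inj.
Qed.

Lemma OS_restr_out b : (val b).1 \notin codom i -> OS_restr loP loQ i (OS_elt loP b) = 0.
Proof.
move=> nb; have rB := OS_restr_zmod i_mono i_down rP loPP loE delU closure.
have r0 : OS_restr loP loQ i 0 = 0 by rewrite -[X in OS_restr _ _ _ X](subrr 0) rB subrr.
have b0 : b != S0.
  apply: contraNneq nb => ->; rewrite /= -(emb_bot i_mono i_down); exact: codom_f.
have [ib|nib] := boolP (indep b); last first.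
  by rewrite OS_elt_dep.
have bI : indep b && (b != S0) by rewrite ib.
rewrite -[b]/(val (Sub b bI : Ipos P)) OS_elt_gen.
rewrite (OS_restr_gen i_mono i_down rP loPP loE delU closure) /restr_gen.
case: pickP => // c /eqP e; case/negP: nb.
by move/(congr1 fst): e => /= <-; apply: codom_f.
Qed.

Lemma OS_restr_comb C :
  OS_restr loP loQ i (OS_comb loP C) = OS_comb loQ (fun b => C (iS b)).
Proof.
have rB := OS_restr_zmod i_mono i_down rP loPP loE delU closure.
have rZ := rat_linear rB.
pose F := GRing.isZmodMorphism.Build _ _ _ rB.
pose g : {additive OS loP -> OS loQ} := HB.pack (OS_restr loP loQ i) F.
transitivity (\sum_b C b *: OS_restr loP loQ i (OS_elt loP b)).
  by apply: etrans (raddf_sum g _ _ _) _; apply: eq_bigr => b _; apply: rZ.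
rewrite (bigID (fun b => b \in codom iS)) /= addrC big1 ?add0r => [|b nb]; last first.
  by rewrite OS_restr_out ?scaler0 // -(embS_codom i_mono i_down rP).
rewrite (eq_bigl [in iS @: [set: Spos Q]]) => [|b]; last first.
  by apply/codomP/imsetP => [[c ->]|[c _ ->]]; exists c; rewrite ?inE.
rewrite big_imset /=; last by move=> ? ? _ _; apply: iS_inj.
apply: eq_big => [b|b _]; first by rewrite in_setT.
by congr (_ *: _); apply: OS_restr_elt.
Qed.

Lemma embS_unicircular_image z w : unicircular z w -> unicircular (iS z) (iS w).
Proof.
move=> /and3P[cz zw /forallP uz].
rewrite /unicircular embS_circuit cz embS_mono zw /=.
apply/forallP => z'; apply/implyP => /andP[cz' z'w].
have [z1 e] := embS_down z'w; rewrite -e (inj_eq iS_inj).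
apply: (implyP (uz z1)); move: cz' z'w; rewrite -e embS_circuit embS_mono => -> //.
Qed.

Hypothesis geoQ : geometric_lattice Q.

(** A linear relation in the algebra of a geometric lattice [Q] may be restricted
    to the terms with a given first component, and then holds in the algebra of
    [P].  Indeed all terms of a circuit relation have the same first component,
    so the truncation, viewed in [P], turns each circuit relation of [Q] into
    zero or into a circuit relation of [P].  Inclusion of [Q] in [P] does not
    respect products, as joins have more elements in [P]; this is why linear
    relations have to be known. *)
Lemma fiber_relation (c : Spos Q -> rat) t : OS_comb loQ c = 0 ->
  \sum_(b | (val b).1 == t) c b *: OS_elt loP (iS b) = 0.
Proof.
move=> c0.
have rQ : ranked Q by case: geoQ.
have loQQ : linear_order_on (atoms Q) loQ.
  have [refl anti trans tot] := loPP.
  have iat a : a \in atoms Q -> i a \in atoms P by rewrite (emb_atoms i_mono i_down rP).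
  split.
  - by move=> a /iat aP; rewrite loE refl.
  - move=> a b /iat aP /iat bP; rewrite !loE => /(anti _ _ aP bP); exact: emb_inj.
  - by move=> b a e /iat bP /iat aP /iat eP; rewrite !loE; apply: trans.
  - by move=> a b /iat aP /iat bP; rewrite !loE; apply: tot.
pose phi b := if (val b).1 == t then OS_elt loP (iS b) else 0.
have phi_dep b : ~~ indep b -> phi b = 0.
  by move=> nb; rewrite /phi OS_elt_dep ?embS_indep ?if_same.
rewrite big_mkcond /=.
transitivity (\sum_b c b *: phi b).
  by apply: eq_bigr => b _; rewrite /phi; case: ifP; rewrite ?scaler0.
apply: (OS_comb_relation loQQ geoQ phi_dep _ c0).
move=> z w zw; have /and3P[cz zw' _] := zw.
have d1 a : a \in atS z -> (val (delS w a)).1 = (val w).1.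
  by move=> az; have [dw dE] := delS_le w a; apply: (geo_circuit_closure geoQ cz zw' az dw dE).
have [wt|wt] := eqVneq (val w).1 t; last first.
  by apply: big1 => a az; rewrite /phi d1 // (negbTE wt) scaler0.
have := OS_relE (OS_rel_circuit loP (embS_unicircular_image zw)).
move=> E; apply: etrans E; apply/esym/(etrans (raddf_sum (quot_pi (OS_proper loP)) _ _ _)).
rewrite atS_embS big_imset /=; last by move=> ? ? _ _; apply: (emb_inj i_mono).
apply: eq_bigr => a az; apply: etrans (quot_pi_scalable _ _ _) _.
have aw : a \in atS w by move: zw'; rewrite (geo_leS geoQ) => /subsetP; apply.
have -> : delS (iS w) (i a) = iS (delS w a).
  by apply: embS_del => b b'; apply: delU.
rewrite atS_embS -imset_set1 (sgn_imset (loT := loQ) (emb_inj i_mono) loE loPP); first last.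
- by rewrite -(atS_embS i_mono i_down rP) atS_atoms.
- by rewrite imset_set1 sub1set (emb_atoms i_mono i_down rP) (subsetP (atS_atoms w)).
have -> : phi (delS w a) = OS_elt loP (iS (delS w a)) by rewrite /phi d1 // wt eqxx.
congr (_ *: _); apply/esym/OS_eltE; rewrite embS_eq0; apply/eqP => d0.
have := d1 _ az; rewrite d0 /= => w0.
have := rank_homo rQ (Spos_ub aw).
have := subsetP (atS_atoms w) _ aw; rewrite inE => /eqP->.
by rewrite -w0 rank0.
Qed.

End IdealTransport.

(** * Global sections *)

Section LocalToGlobal.
Context {d : Order.disp_t} {P : finBPOrderType d} (lo : rel P).
Hypothesis lo_lin : linear_order_on (atoms P) lo.
Hypothesis lgP : locally_geometric P.
Let rP : ranked P := lgP.1.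

Definition down_top (x : P) : down x := exist _ x (lexx x).

Section DownInclusion.
Variable x : P.
Definition down_val : down x -> P := val.
Fact down_val_mono : {mono down_val : a b / (a <= b)%O}. Proof. by []. Qed.
Fact down_val_down p q : (p <= down_val q)%O -> exists q', down_val q' = p.
Proof. by move=> pq; exists (Sub p (le_trans pq (valP q))). Qed.
Definition down_S : Spos (down x) -> Spos P := embS down_val_mono down_val_down rP.

Lemma down_S_onto (w : Spos P) : ((val w).1 <= x)%O -> exists v, down_S v = w.
Proof.
move=> wx; have /codomP[v ->] : w \in codom down_S; last by exists v.
by rewrite embS_codom; apply/codomP; exists (exist _ (val w).1 wx : down x).
Qed.
End DownInclusion.

Section ResInclusion.
Variables (x y : P) (le_yx : (y <= x)%O).
Fact down_incl_mono : {mono down_incl le_yx : a b / (a <= b)%O}. Proof. by []. Qed.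
Fact down_incl_down p q :
  (p <= down_incl le_yx q)%O -> exists q', down_incl le_yx q' = p.
Proof.
move=> pq; exists (Sub (val p) (le_trans (pq : (val p <= val q)%O) (valP q))).
exact: val_inj.
Qed.
Definition res_S : Spos (down y) -> Spos (down x) :=
  embS down_incl_mono down_incl_down (emb_ranked (@down_val_mono x) (@down_val_down x) rP).

Lemma down_S_res b : down_S (res_S b) = down_S b.
Proof. by apply: Spos_eq => //; rewrite !atS_embS -imset_comp. Qed.
End ResInclusion.

(** This fact and the next one only involve elements of [S] below [w], hence
    hold in [P] because they hold in a geometric lattice. *)
Lemma lg_del_unique (w b b' : Spos P) :
  (b <= w)%O -> (b' <= w)%O -> atS b = atS b' -> b = b'.
Proof.
have [v <-] := down_S_onto (lexx (val w).1).
move=> /embS_down[c <-] /embS_down[c' <-]; rewrite !atS_embS.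
move=> /(imset_inj (emb_inj (@down_val_mono _))) e; congr embS.
exact: geo_atS_inj (lgP.2 _) _ _ e.
Qed.

Lemma lg_circuit_closure (z w b : Spos P) a :
  circuit z -> (z <= w)%O -> a \in atS z -> (b <= w)%O ->
  atS b = atS w :\ a -> (val b).1 = (val w).1.
Proof.
have [v <-] := down_S_onto (lexx (val w).1).
move=> cz zv az bv; have [z' ez] := embS_down zv; have [b' eb] := embS_down bv.
have inj := emb_inj (@down_val_mono (val w).1).
move: cz zv az bv; rewrite -ez -eb !embS_mono embS_circuit !atS_embS.
move=> cz zv /imsetP[a' a'z ->] bv e.
congr down_val; apply: (geo_circuit_closure (lgP.2 _) cz zv a'z bv).
by apply/setP => t; rewrite -(mem_imset _ _ inj) e !inE (mem_imset _ _ inj) (inj_eq inj).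
Qed.

Definition restr_to (x : P) : OS lo -> OSx lo x := OS_restr lo (@down_ord _ _ lo x) (@down_val x).

Section RestrTo.
Variable x : P.

Lemma restr_to_zmod : zmod_morphism (restr_to x).
Proof.
exact: (OS_restr_zmod (@down_val_mono x) (@down_val_down x) rP lo_lin
  (fun _ _ => erefl) lg_del_unique lg_circuit_closure).
Qed.

Lemma restr_to_monoid : monoid_morphism (restr_to x).
Proof.
exact: (OS_restr_monoid (@down_val_mono x) (@down_val_down x) rP lo_lin
  (fun _ _ => erefl) lg_del_unique lg_circuit_closure).
Qed.

Lemma restr_to_comb C :
  restr_to x (OS_comb lo C) = OS_comb (@down_ord _ _ lo x) (fun b => C (down_S b)).
Proof.
exact: (OS_restr_comb (@down_val_mono x) (@down_val_down x) rP lo_lin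
  (fun _ _ => erefl) lg_del_unique lg_circuit_closure).
Qed.

Lemma down_fiber_relation (c : Spos (down x) -> rat) t :
  OS_comb (@down_ord _ _ lo x) c = 0 ->
  \sum_(b | (val b).1 == t) c b *: OS_elt lo (down_S b) = 0.
Proof.
exact: (fiber_relation (@down_val_mono x) (@down_val_down x) rP lo_lin
  (fun _ _ => erefl) lg_del_unique (lgP.2 x)).
Qed.

Lemma OSx_spanned (u : OSx lo x) : exists C : Spos P -> rat,
  u = OS_comb (@down_ord _ _ lo x) (fun b => C (down_S b)).
Proof.
have [c ->] := OS_spanned u.
have sumE b : \sum_(e | down_S e == down_S b) c e = c b.
  by apply: big_pred1 => e; rewrite /= (inj_eq (emb_inj (embS_mono _ _ _))).
exists (fun b => \sum_(e | down_S e == b) c e).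
by apply: eq_bigr => b _; rewrite sumE.
Qed.
End RestrTo.

Section ResComb.
Variables (x y : P) (le_yx : (y <= x)%O).

Lemma OS_res_comb (C : Spos P -> rat) :
  OS_res (lo := lo) le_yx (OS_comb (@down_ord _ _ lo x) (fun b => C (down_S b))) =
  OS_comb (@down_ord _ _ lo y) (fun b => C (down_S b)).
Proof.
rewrite /OS_res (OS_restr_comb (down_incl_mono le_yx) (@down_incl_down _ _ le_yx)
  (emb_ranked (@down_val_mono x) (@down_val_down x) rP)
  (down_ord_linear lo_lin lgP x) (fun _ _ => erefl)
  (@geo_del_unique _ _ (lgP.2 x)) (@geo_circuit_closure _ _ (lgP.2 x))).
by apply: eq_bigr => b _; rewrite -(down_S_res le_yx).
Qed.

Lemma res_fiber_relation (c : Spos (down y) -> rat) t :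
  OS_comb (@down_ord _ _ lo y) c = 0 ->
  \sum_(b | (val b).1 == t) c b *: OS_elt (@down_ord _ _ lo x) (res_S le_yx b) = 0.
Proof.
exact: (fiber_relation (down_incl_mono le_yx) (@down_incl_down _ _ le_yx)
  (emb_ranked (@down_val_mono x) (@down_val_down x) rP)
  (down_ord_linear lo_lin lgP x) (fun _ _ => erefl)
  (@geo_del_unique _ _ (lgP.2 x)) (lgP.2 y)).
Qed.
End ResComb.

(** The part of the combination with first component [x] is already a relation
    in [P_{<=x}], hence a relation in [P]; sum over [x]. *)
Lemma OS_comb_local (C : Spos P -> rat) :
  (forall x, restr_to x (OS_comb lo C) = 0) -> OS_comb lo C = 0.
Proof.
move=> C0; rewrite /OS_comb (partition_big (fun b => (val b).1) xpredT) //=.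
apply: big1 => x _.
have := C0 x; rewrite restr_to_comb => /(down_fiber_relation (down_top x)) E.
by rewrite -[RHS]E (sum_embS_fiber (@down_val_mono x) (@down_val_down x) rP _ (down_top x)).
Qed.

(** Expand each [t x] and keep the coefficients of its terms with first
    component [x].  At [y] the resulting combination differs from [t y], for
    each [x <= y], by the top part of a relation holding in [P_{<=x}], namely
    the compatibility of [t x] with [t y]. *)
Lemma OS_extend (V : {set P}) (t : osection V) : order_ideal V ->
  exists a : OS lo, forall x (xV : x \in V), restr_to x a = t x xV.
Proof.
move=> idV.
have /choice[C CE] x : exists C : Spos P -> rat, forall xV : x \in V,
    t x xV = OS_comb (@down_ord _ _ lo x) (fun b => C (down_S b)).
  have [xV|nxV] := pselect (x \in V); last by exists (fun=> 0) => xV; case: nxV.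
  have [C E] := OSx_spanned (t x xV); exists C => xV'.
  by rewrite (bool_irrelevance xV' xV).
exists (OS_comb lo (fun b => C (val b).1 b)) => y yV; rewrite restr_to_comb (CE y yV).
pose deg (b : Spos (down y)) := (val b).1.
rewrite /OS_comb.
apply: etrans (partition_big deg xpredT _) _; first by [].
apply: esym.
apply: etrans (partition_big deg xpredT _) _; first by [].
apply: esym.
apply: eq_bigr => x' _; pose x := val x'; have xy : (x <= y)%O := valP x'.
have xV : x \in V by apply: idV xy.
have x'E : x' = down_incl xy (down_top x) by apply: val_inj.
pose F b := (C x (down_S b) - C y (down_S b)) *: OS_elt (@down_ord _ _ lo y) b.
have relx : OS_comb (@down_ord _ _ lo x) (fun b => C x (down_S b) - C y (down_S b)) = 0.
  have := sec_compat t yV xV xy; rewrite (CE y) (CE x) OS_res_comb => E.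
  rewrite /OS_comb; under eq_bigr do rewrite scalerBl.
  by rewrite sumrB; apply/eqP; rewrite subr_eq0 eq_sym; apply/eqP.
have F0 : \sum_(b : Spos (down y) | (val b).1 == x') F b = 0.
  rewrite x'E (sum_embS_fiber (down_incl_mono xy) (@down_incl_down _ _ xy)
    (emb_ranked (@down_val_mono y) (@down_val_down y) rP) F).
  apply: etrans (res_fiber_relation xy (down_top x) relx).
  by apply: eq_bigr => b _; rewrite /F (down_S_res xy b).
apply/eqP; rewrite -subr_eq0 -sumrB -[X in _ == X]F0; apply/eqP.
by apply: eq_bigr => b /eqP bx; rewrite /F scalerBl embS1 -[(val b).1]/(deg b) bx.
Qed.

Definition global_section (a : OS lo) : OSsheaf lo_lin lgP [set: P].
Proof.
exists (fun x _ => restr_to x a) => x y _ _ le_yx.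
by have [C ->] := OS_spanned a; rewrite !restr_to_comb OS_res_comb.
Defined.

Fact global_section_zmod : zmod_morphism global_section.
Proof. by move=> a b; apply: osectionP => x xU; apply: restr_to_zmod. Qed.
Fact global_section_monoid : monoid_morphism global_section.
Proof.
by split=> [|a b]; apply: osectionP => x xU; have [r1 rM] := restr_to_monoid x;
  [apply: r1|apply: rM].
Qed.
Fact global_section_scalable : scalable global_section.
Proof.
by move=> k a; apply: osectionP => x xU; apply: (rat_linear (restr_to_zmod x)).
Qed.
HB.instance Definition _ := GRing.isZmodMorphism.Build _ _ global_section global_section_zmod.
HB.instance Definition _ :=
  GRing.isMonoidMorphism.Build _ _ global_section global_section_monoid.
HB.instance Definition _ :=
  GRing.isScalable.Build rat _ _ *:%R global_section global_section_scalable.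

Lemma global_section_bij : bijective global_section.
Proof.
have inj : injective global_section.
  move=> a b ab; apply/eqP; rewrite -subr_eq0; apply/eqP.
  have [C E] := OS_spanned (a - b); rewrite E; apply: OS_comb_local => x.
  rewrite -E restr_to_zmod; apply/eqP; rewrite subr_eq0; apply/eqP.
  exact: (congr1 (fun s : OSsheaf lo_lin lgP [set: P] => s x (in_setT x)) ab).
have surj s : exists a, global_section a = s.
  have [|a aE] := @OS_extend setT s; first by move=> x y; rewrite !inE.
  exists a.
  by apply: osectionP => x xU; apply: aE.
have [g gK] := choice surj; exists g => // a.
exact: inj.
Qed.

End LocalToGlobal.

Section Sheaf.
Context {d : Order.disp_t} {P : finBPOrderType d} (lo : rel P).
Hypothesis lo_lin : linear_order_on (atoms P) lo.
Hypothesis lgP : locally_geometric P.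

Lemma OSsheaf_is_sheaf : is_sheaf (fun U V VU => @sec_res d P lo lo_lin lgP U V VU).
Proof.
move=> I U V VU _ idV cov t glue.
have tE i i' x (xi : x \in V i) (xi' : x \in V i') : t i x xi = t i' x xi'.
  have xI : x \in V i :&: V i' by rewrite inE xi.
  have := congr1 (fun s : OSsheaf lo_lin lgP (V i :&: V i') => s x xI) (glue i i').
  by rewrite /= (bool_irrelevance (subsetP _ _ _) xi) (bool_irrelevance (subsetP _ _ _) xi').
pose ix x (xU : x \in U) := cid (cov x xU).
have s_compat x y (xU : x \in U) (yU : y \in U) (le_yx : (y <= x)%O) :
    OS_res le_yx (t _ x (svalP (ix x xU))) = t _ y (svalP (ix y yU)).
  have yV := idV _ _ _ (svalP (ix x xU)) le_yx.
  by rewrite (sec_compat _ _ yV); apply: tE.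
exists (OSection s_compat); split=> [i|s sE].
  by apply: osectionP => x xV; apply: tE.
apply: osectionP => x xU; have xV := svalP (ix x xU).
have := congr1 (fun r : OSsheaf lo_lin lgP (V (sval (ix x xU))) => r x xV) (sE _).
move=> E; apply: etrans (tE _ _ _ _ xV) (etrans (esym E) _).
by congr (sec_val s); apply: bool_irrelevance.
Qed.

Lemma OSsheaf_flasque : flasque (fun U V VU => @sec_res d P lo lo_lin lgP U V VU).
Proof.
move=> U V VU _ idV t; have [a aE] := OS_extend lo_lin lgP t idV.
exists (sec_res (subsetT U) (global_section lo_lin lgP a)).
by apply: osectionP => x xV; apply: aE.
Qed.

End Sheaf.

Theorem theorem3p4p2 (d : Order.disp_t) (P : finBPOrderType d) (lo : rel P)
    (lo_lin : linear_order_on (atoms P) lo) (lgP : locally_geometric P) :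
  [/\ is_sheaf (fun U V VU => @sec_res d P lo lo_lin lgP U V VU),
      flasque (fun U V VU => @sec_res d P lo lo_lin lgP U V VU)
    & exists f : {lrmorphism OS lo -> OSsheaf lo_lin lgP [set: P]}, bijective f].
Proof.
split; [exact: OSsheaf_is_sheaf|exact: OSsheaf_flasque|].
exists (global_section lo_lin lgP); exact: global_section_bij.
Qed.
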